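(* Let $\mathbb{F}=\mathbb{R}$ or $\mathbb{C}$, let $n\geq 2$, and let $T$ be a random matrix uniformly distributed in the unit ball $K_\infty$ of the operator norm on $\mathcal{M}_n(\mathbb{F})$. Then the negative correlation property fails for all pairs of entries of $T$ that lie neither in the same row nor in the same column: for all $i\neq l$ and $j\neq r$ in $\{1,\dots,n\}$, the inequality $$\frac{1}{\mathrm{vol}(K_\infty)}\int_{K_\infty}|T_{i,j}|^2|T_{l,r}|^2\,dT<\left(\frac{1}{\mathrm{vol}(K_\infty)}\int_{K_\infty}|T_{i,j}|^2\,dT\right)\left(\frac{1}{\mathrm{vol}(K_\infty)}\int_{K_\infty}|T_{l,r}|^2\,dT\right)$$ does not hold.
   Context: $\mathcal{M}_n(\mathbb{F})$ is the space of $n\times n$ matrices over $\mathbb{F}$, viewed as a real Euclidean space with the Hilbert-Schmidt norm; $\mathrm{vol}$ and $dT$ refer to Lebesgue measure. $K_\infty=\{T\in\mathcal{M}_n(\mathbb{F}):s_{\max}(T)\leq1\}$, where $s_{\max}(T)$ is the largest singular value of $T$. *)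

(* Defs.v *)
From HB Require Import structures.
From mathcomp Require Import all_boot all_order all_algebra.
From mathcomp Require Import all_classical all_reals all_analysis.
From mathcomp Require Import complex.

Set Implicit Arguments.
Unset Strict Implicit.
Unset Printing Implicit Defensive.

Import Order.TTheory GRing.Theory Num.Theory.

Local Open Scope classical_set_scope.
Local Open Scope ring_scope.

Section sigma_finite_measure_ex.
Context d (T : measurableType d) (R : realType) (m : {measure set T -> \bar R}).
Hypothesis sm : sigma_finite setT m.

Let m' : set T -> \bar R := m.
HB.instance Definition _ := Measure.on m'.
HB.instance Definition _ := Measure_isSigmaFinite.Build _ _ _ m' sm.

Lemma sigma_finite_measure_ex :
  exists q : {sigma_finite_measure set T -> \bar R}, m = q :> (set T -> \bar R).
Proof. by exists m'. Qed.

End sigma_finite_measure_ex.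

Section measure_facts.
Local Open Scope ereal_scope.
Context d d' (T : measurableType d) (T' : measurableType d') (R : realType).

Lemma pushforward_semi_sigma_additive (m : {measure set T -> \bar R})
    (f : T -> T') :
  measurable_fun setT f -> semi_sigma_additive (pushforward m f).
Proof.
move=> mf F mF tF mUF; rewrite /pushforward preimage_bigcup.
have mpre A : measurable A -> measurable (f @^-1` A).
  by move=> mA; rewrite -[X in measurable X]setTI; exact: mf.
apply: measure_semi_sigma_additive.
- by move=> n; exact: mpre.
- apply/trivIsetP => /= i j _ _ ij; rewrite -preimage_setI.
  by move/trivIsetP : tF => /(_ _ _ _ _ ij) ->//; rewrite preimage_set0.
- by rewrite -preimage_bigcup; exact: mpre.
Qed.

Lemma pushforward_sigma_finite (m : {measure set T -> \bar R})
    (f : T -> T') (g : T' -> T) :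
  measurable_fun setT g -> cancel f g -> sigma_finite setT m ->
  sigma_finite setT (pushforward m f).
Proof.
move=> mg fK [F TF Foo].
exists (fun n => g @^-1` F n).
  by rewrite -preimage_bigcup -TF preimage_setT.
move=> n; have [mF Fn] := Foo n; split.
  by rewrite -[X in measurable X]setTI; exact: mg.
by rewrite /pushforward -comp_preimage (_ : g \o f = id) //; exact/funext.
Qed.

Lemma sigma_finite_pushforward_ex (m : {measure set T -> \bar R})
    (f : T -> T') (g : T' -> T) (mf : measurable_fun setT f) :
  measurable_fun setT g -> cancel f g -> sigma_finite setT m ->
  exists m' : {sigma_finite_measure set T' -> \bar R},
    pushforward m f = m' :> (set T' -> \bar R).
Proof.
move=> mg fK sm.
pose q : {measure set T' -> \bar R} :=
  measure_function_pushforward__canonical__measure_function_Measure m mf.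
exact: (@sigma_finite_measure_ex _ _ _ q (pushforward_sigma_finite mg fK sm)).
Qed.

Lemma product_sigma_finite (m : {sigma_finite_measure set T -> \bar R})
    (m' : {sigma_finite_measure set T' -> \bar R}) :
  sigma_finite setT (m \x m').
Proof.
have /sigma_finiteP[F [TF ndF Foo]] := sigma_finiteT m.
have /sigma_finiteP[G [TG ndG Goo]] := sigma_finiteT m'.
exists (fun n => F n `*` G n).
  rewrite -setXTT TF TG predeqE => -[x y]; split.
    move=> [/= [n _ Fnx] [k _ Gky]]; exists (maxn n k) => //; split.
    - by move: x Fnx; exact/subsetPset/ndF/leq_maxl.
    - by move: y Gky; exact/subsetPset/ndG/leq_maxr.
  by move=> [n _ []/= ? ?]; split; exists n.
move=> k; have [? ?] := Foo k; have [? ?] := Goo k.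
split; first exact: measurableX.
by rewrite product_measure1E// lte_mul_pinfty// ge0_fin_numE.
Qed.

End measure_facts.

Section tuple_power.
Local Open Scope ereal_scope.
Context d (T : measurableType d) (R : realType).

(* The k-fold product measure mu \x ... \x mu. *)
Fixpoint tuple_power (mu : set T -> \bar R) (k : nat) :
    set (k.-tuple T) -> \bar R :=
  if k is k'.+1 then
    pushforward (mu \x tuple_power mu (k := k'))
      (fun x : T * k'.-tuple T => [tuple of x.1 :: x.2])
  else \d_[tuple].

Variable mu : {sigma_finite_measure set T -> \bar R}.

Let tuple_power_ex k :
  exists m : {sigma_finite_measure set (k.-tuple T) -> \bar R},
  tuple_power mu (k := k) = m.
Proof.
elim: k => [|k [m mE]]; first by exists (\d_ ([tuple] : 0.-tuple T)).
have mf : measurable_fun setT (fun x : T * k.-tuple T => [tuple of x.1 :: x.2]).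
  exact: measurable_cons.
have mg : measurable_fun setT
    (fun t : k.+1.-tuple T => (thead t, [tuple of behead t])).
  apply: measurable_fun_pair; first exact: measurable_tnth.
  exact: measurable_behead.
have [||q qE] := sigma_finite_pushforward_ex (m := mu \x m) mf mg.
- by move=> [x t]/=; congr pair; exact: val_inj.
- exact: (product_sigma_finite mu m).
by exists q; rewrite -qE/= mE.
Qed.

Variable k : nat.

Let tuple_power0 : tuple_power mu (k := k) set0 = 0.
Proof. by have [m ->] := tuple_power_ex k. Qed.

Let tuple_power_ge0 A : 0 <= tuple_power mu (k := k) A.
Proof. by have [m ->] := tuple_power_ex k. Qed.

Let tuple_power_semi_sigma_additive :
  semi_sigma_additive (tuple_power mu (k := k)).
Proof.
by have [m ->] := tuple_power_ex k; exact: measure_semi_sigma_additive.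
Qed.

HB.instance Definition _ := isMeasure.Build _ _ _ (tuple_power mu (k := k))
  tuple_power0 tuple_power_ge0 tuple_power_semi_sigma_additive.

Let tuple_power_sigma_finite : sigma_finite setT (tuple_power mu (k := k)).
Proof. by have [m ->] := tuple_power_ex k; exact: sigma_finiteT. Qed.

HB.instance Definition _ := Measure_isSigmaFinite.Build _ _ _
  (tuple_power mu (k := k)) tuple_power_sigma_finite.

End tuple_power.

Section tuple_power_box.
Local Open Scope ereal_scope.
Context d (T : measurableType d) (R : realType).
Variable mu : {sigma_finite_measure set T -> \bar R}.

Lemma measurable_tuple_box k (A : 'I_k -> set T) :
  (forall i, measurable (A i)) ->
  measurable [set t : k.-tuple T | forall i, A i (tnth t i)].
Proof.
move=> mA; rewrite (_ : mkset _ =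
    \bigcap_(i in [set: 'I_k]) ((fun t : k.-tuple T => tnth t i) @^-1` A i)).
  apply: fin_bigcap_measurable; first exact: finite_finset.
  move=> i _.
  by rewrite -[X in measurable X]setTI; exact: measurable_tnth.
by apply/seteqP; split => [t tA i _|t tA i]; exact: tA.
Qed.

Lemma tuple_power_box k (A : 'I_k -> set T) : (forall i, measurable (A i)) ->
  tuple_power mu [set t : k.-tuple T | forall i, A i (tnth t i)] =
  \prod_(i < k) mu (A i).
Proof.
elim: k A => [|k IHk] A mA.
  by rewrite big_ord0 /= diracE mem_set//= => -[].
rewrite big_ord_recl -(IHk (fun i => A (lift ord0 i)))//.
rewrite -(product_measure1E mu (tuple_power mu (k := k)))//; last first.
  by apply: (@measurable_tuple_box _ (fun i => A (lift ord0 i))) => i; exact: mA.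
rewrite /= /pushforward; congr (_ \x _).
apply/seteqP; split => [[x t]/= xtA|[x t]/= [xA tA] i].
  split; first exact: (xtA ord0).
  by move=> i; have := xtA (lift ord0 i); rewrite tnthS.
by case: (unliftP ord0 i) => [j ->|->//]; rewrite tnthS.
Qed.

End tuple_power_box.

Definition measure_matrix_display : measure_display -> measure_display.
Proof. exact. Qed.

Section measurable_matrix.
Context d (T : measurableType d) (m n : nat).

Definition entry_cylinders : set (set 'M[T]_(m, n)) :=
  \bigcup_(ij in [set: 'I_m * 'I_n])
    preimage_set_system setT (fun M : 'M[T]_(m, n) => M ij.1 ij.2) measurable.

Let matrix_set0 : <<s entry_cylinders >> set0.
Proof. exact: sigma_algebra0. Qed.

Let matrix_setC A : <<s entry_cylinders >> A -> <<s entry_cylinders >> (~` A).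
Proof. exact: sigma_algebraC. Qed.

Let matrix_bigcup (F : (set 'M[T]_(m, n))^nat) :
  (forall i, <<s entry_cylinders >> (F i)) ->
  <<s entry_cylinders >> (\bigcup_i (F i)).
Proof. exact: sigma_algebra_bigcup. Qed.

HB.instance Definition _ := @isMeasurable.Build (measure_matrix_display d)
  'M[T]_(m, n) <<s entry_cylinders >> matrix_set0 matrix_setC matrix_bigcup.

Lemma measurable_entry i j :
  measurable_fun [set: 'M[T]_(m, n)] (fun M => M i j).
Proof.
move=> _ A mA; rewrite setTI; apply: sub_sigma_algebra.
by exists (i, j) => //; exists A => //; rewrite setTI.
Qed.

Lemma measurable_fun_matrix d' (X : measurableType d')
    (f : X -> 'M[T]_(m, n)) :
  (forall i j, measurable_fun setT (fun x => f x i j)) -> measurable_fun setT f.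
Proof.
move=> mf; have sub : entry_cylinders `<=` image_set_system setT f measurable.
  move=> _ [[i j] _ [A mA <-]]; rewrite /image_set_system/= !setTI.
  by rewrite -[X in measurable X]setTI; exact: mf.
move=> _ A mA; suff : image_set_system setT f measurable A by [].
move: mA; apply: smallest_sub => //.
exact/sigma_algebra_image/sigma_algebra_measurable.
Qed.

End measurable_matrix.

Section matrix_power.
Local Open Scope ereal_scope.
Context d (T : measurableType d) (R : realType).

(* The product of m * n copies of mu, one for each entry of the matrix. *)
Definition matrix_power (mu : set T -> \bar R) (m n : nat) :
    set 'M[T]_(m, n) -> \bar R :=
  pushforward (tuple_power (tuple_power mu (k := n)) (k := m))
    (fun t : m.-tuple (n.-tuple T) =>
       \matrix_(i < m, j < n) tnth (tnth t i) j)%R.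

Variables (mu : {sigma_finite_measure set T -> \bar R}) (m n : nat).

Let mx_measurable : measurable_fun setT (fun t : m.-tuple (n.-tuple T) =>
  (\matrix_(i < m, j < n) tnth (tnth t i) j)%R : 'M[T]_(m, n)).
Proof.
apply: measurable_fun_matrix => i j; under eq_fun do rewrite mxE.
apply: (@measurableT_comp _ _ _ _ _ _ (fun t => tnth t j)) => //=;
  exact: measurable_tnth.
Qed.

Let matrix_power0 : matrix_power mu (m := m) (n := n) set0 = 0.
Proof. exact: measure0. Qed.

Let matrix_power_ge0 A : 0 <= matrix_power mu (m := m) (n := n) A.
Proof. exact: measure_ge0. Qed.

Let matrix_power_semi_sigma_additive :
  semi_sigma_additive (matrix_power mu (m := m) (n := n)).
Proof. exact: pushforward_semi_sigma_additive. Qed.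

HB.instance Definition _ := isMeasure.Build _ _ _
  (matrix_power mu (m := m) (n := n))
  matrix_power0 matrix_power_ge0 matrix_power_semi_sigma_additive.

Lemma matrix_power_box (A : 'I_m -> 'I_n -> set T) :
  (forall i j, measurable (A i j)) ->
  matrix_power mu [set M : 'M[T]_(m, n) | forall i j, A i j (M i j)] =
  \prod_(i < m) \prod_(j < n) mu (A i j).
Proof.
move=> mA; under [RHS]eq_bigr do rewrite -tuple_power_box//.
rewrite -tuple_power_box//; last by move=> i; exact: measurable_tuple_box.
rewrite /matrix_power /pushforward; congr (tuple_power _ _).
by apply/seteqP; split => t/= tA i j; have := tA i j; rewrite mxE.
Qed.

End matrix_power.

Definition measure_complex_display : measure_display -> measure_display.
Proof. exact. Qed.

Section lebesgue_complex.
Local Open Scope ereal_scope.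
Local Open Scope complex_scope.
Context (R : realType).

Definition complex_coord (z : R[i]) : measurableTypeR R * measurableTypeR R :=
  (complex.Re z, complex.Im z).

Let pre := preimage_set_system setT complex_coord measurable.

Let complex_sigma : sigma_algebra setT pre.
Proof. exact/sigma_algebra_preimage/sigma_algebra_measurable. Qed.

HB.instance Definition _ := isPointed.Build R[i] 0%R.

Let complex_set0 : pre set0. Proof. by case: complex_sigma. Qed.

Let complex_setC A : pre A -> pre (~` A).
Proof. by case: complex_sigma => _ h _ /h; rewrite setTD. Qed.

Let complex_bigcup (F : (set R[i])^nat) :
  (forall i, pre (F i)) -> pre (\bigcup_i (F i)).
Proof. by case: complex_sigma => _ _; exact. Qed.

HB.instance Definition _ := @isMeasurable.Build
  (measure_complex_display default_measure_display) R[i] pre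
  complex_set0 complex_setC complex_bigcup.

Definition lebesgue_complex : set R[i] -> \bar R :=
  pushforward (@lebesgue_measure R \x @lebesgue_measure R)
    (fun p => p.1 +i* p.2).

Let mkC (p : measurableTypeR R * measurableTypeR R) : R[i] := p.1 +i* p.2.

Let mkCK : cancel mkC complex_coord. Proof. by case. Qed.

Let measurable_mkC : measurable_fun setT mkC.
Proof.
move=> _ _ [A mA <-]; rewrite !setTI -comp_preimage.
by rewrite (_ : complex_coord \o mkC = id)//; exact/funext.
Qed.

Let measurable_coord : measurable_fun setT complex_coord.
Proof. by move=> _ A mA; exists A. Qed.

Let lebesgue_complex0 : lebesgue_complex set0 = 0.
Proof. exact: measure0. Qed.

Let lebesgue_complex_ge0 A : 0 <= lebesgue_complex A.
Proof. exact: measure_ge0. Qed.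

Let lebesgue_complex_semi_sigma_additive :
  semi_sigma_additive lebesgue_complex.
Proof. exact: (pushforward_semi_sigma_additive measurable_mkC). Qed.

HB.instance Definition _ := isMeasure.Build _ _ _ lebesgue_complex
  lebesgue_complex0 lebesgue_complex_ge0 lebesgue_complex_semi_sigma_additive.

Let lebesgue_complex_sigma_finite : sigma_finite setT lebesgue_complex.
Proof.
apply: (pushforward_sigma_finite measurable_coord mkCK).
exact: (product_sigma_finite lebesgue_measure lebesgue_measure).
Qed.

HB.instance Definition _ := Measure_isSigmaFinite.Build _ _ _ lebesgue_complex
  lebesgue_complex_sigma_finite.

Lemma lebesgue_complex_box (A B : set (measurableTypeR R)) :
  measurable A -> measurable B ->
  lebesgue_complex [set z | A (complex.Re z) /\ B (complex.Im z)] =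
  lebesgue_measure A * lebesgue_measure B.
Proof.
move=> mA mB; rewrite /lebesgue_complex.
exact: (product_measure1E lebesgue_measure lebesgue_measure).
Qed.

End lebesgue_complex.

Notation normc := ComplexField.Normc.normc.

Section operator_norm_ball.
Context (R : realType) (n : nat).
Local Open Scope complex_scope.

Definition singular_values_real (T : 'M[R]_n) : set R :=
  [set s | 0 <= s /\ eigenvalue (T^T *m T) (s ^+ 2)].

Definition singular_values_complex (T : 'M[R[i]]_n) : set R :=
  [set s | 0 <= s /\ eigenvalue ((map_mx conjc T)^T *m T) (s ^+ 2)%:C].

(* For n > 0 the set of singular values is finite and nonempty, so that the   *)
(* supremum below is the largest singular value.                              *)
Definition smax_real (T : 'M[R]_n) : R := sup (singular_values_real T).
Definition smax_complex (T : 'M[R[i]]_n) : R := sup (singular_values_complex T).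

Definition Kinfty_real : set 'M[R]_n := [set T | smax_real T <= 1].
Definition Kinfty_complex : set 'M[R[i]]_n := [set T | smax_complex T <= 1].

(* The entries (resp. their real and imaginary parts) are the coordinates in  *)
(* an orthonormal basis for the Hilbert-Schmidt norm, so these product        *)
(* measures are the Lebesgue measures of the Euclidean spaces of matrices.    *)
(* measurableTypeR R is R itself, under the name by which lebesgue_measure    *)
(* finds its Borel sigma-algebra.                                             *)
Definition vol_real : {measure set 'M[measurableTypeR R]_n -> \bar R} :=
  matrix_power lebesgue_measure (m := n) (n := n).
Definition vol_complex : {measure set 'M[R[i]]_n -> \bar R} :=
  matrix_power (@lebesgue_complex R) (m := n) (n := n).

(* Averages over the ball: expectations for the uniform distribution on it.   *)
Definition mean_real (f : 'M[R]_n -> R) : R :=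
  (fine (vol_real Kinfty_real))^-1 * \int[vol_real]_(T in Kinfty_real) f T.
Definition mean_complex (f : 'M[R[i]]_n -> R) : R :=
  (fine (vol_complex Kinfty_complex))^-1 *
  \int[vol_complex]_(T in Kinfty_complex) f T.

End operator_norm_ball.

(* Main.v *)
From HB Require Import structures.
Require Import Defs.
From mathcomp Require Import all_boot all_order all_algebra.
From mathcomp Require Import all_classical all_reals all_analysis.
From mathcomp Require Import measurable_realfun.
From mathcomp Require Import complex.
From mathcomp Require Import ring lra.

(** Fix the entry x = T i j and write y for the rest of row i, z for the rest
    of column j and W for the complementary block, which contains T l r.  For
    |x| < 1 put s = sqrt (1 - |x|^2).  The matrix with blocks
    (x, s y; s z, W - conj x z y) arises from the matrix with blocks
    (0, y; z, W) by feeding its pivot output back to its pivot input through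
    the unitary matrix (x, s; s, - conj x).  A unitary feedback preserves the
    energy balance, so one of the two matrices is a contraction iff the other
    is ([contraction_slice]).  The unit ball being the set of contractions
    ([Kinfty_realE], [Kinfty_complexE]), its slice over x is thus the image of
    the slice over 0 under a dilation of y and z by s followed by a shear of W,
    and the Jacobian depends on |x| only ([integral_julia]).

    Conditionally on x, the entry T l r is therefore W l r - conj x z l y r,
    with (y, z, W) distributed independently of x.  The cross term of its
    squared modulus is odd in x and averages to zero, so that the conditional
    mean of |T l r|^2 is alpha + beta |x|^2 with beta >= 0, and the covariance
    of |T i j|^2 and |T l r|^2 is beta times the variance of |x|^2.  Without
    normalizing: with p k the moments of |x|^2 for the weight of the slices,
    V the mass of the slice over 0, and a, b its integrals of |W l r|^2 and
    |z l|^2 |y r|^2, one has vol K = p 0 V, and the integrals over K of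
    |T i j|^2, |T l r|^2 and their product are p 1 V, p 0 a + p 1 b and
    p 1 a + p 2 b ([ball_pivot_moment], [ball_pair_moment]).  The claim
    becomes V b (p 0 p 2 - (p 1)^2) >= 0, which is the Cauchy-Schwarz
    inequality.

    Integrals over matrix space are handled one entry at a time: exchanging an
    entry with an auxiliary independent variable preserves the product
    measure, which yields a Fubini formula for that entry ([entry_fubini]) and
    then the change of variables formula for entrywise affine maps
    ([integral_affine_entries]).  The real and the complex case are two
    instances of one argument over an abstract type of scalars embedded in the
    complex numbers ([scalar_model]). *)

Set Implicit Arguments.
Unset Strict Implicit.
Unset Printing Implicit Defensive.

Import Order.TTheory GRing.Theory Num.Theory.
Import numFieldNormedType.Exports.

Local Open Scope classical_set_scope.
Local Open Scope ring_scope.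

(** * The unit ball as the set of contractions *)

Section contraction.
Context (R : realType).
Local Open Scope complex_scope.
Local Open Scope sesquilinear_scope.
Implicit Types z w : R[i].

Definition sqmod z : R := complex.Re z ^+ 2 + complex.Im z ^+ 2.

Lemma sqmod_normc z : normc z ^+ 2 = sqmod z.
Proof. by case: z => a b; rewrite /= sqr_sqrtr// addr_ge0 ?sqr_ge0. Qed.

Lemma sqmod_ge0 z : 0 <= sqmod z.
Proof. by rewrite addr_ge0 ?sqr_ge0. Qed.

Lemma sqmodE z : (sqmod z)%:C = z^* * z.
Proof. by case: z => a b; rewrite /sqmod; simpc; congr Complex => /=; ring. Qed.

Lemma sqmod_eq0 z : sqmod z = 0 -> z = 0.
Proof.
case: z => a b /eqP; rewrite /sqmod paddr_eq0 ?sqr_ge0//= !sqrf_eq0.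
by move=> /andP[/eqP -> /eqP ->].
Qed.

Lemma sqmodM z w : sqmod (z * w) = sqmod z * sqmod w.
Proof. by case: z w => [a b] [c d]; rewrite /sqmod/=; ring. Qed.

Lemma sqmod0 : sqmod 0 = 0. Proof. by rewrite /sqmod/=; ring. Qed.
Lemma sqmod1 : sqmod 1 = 1. Proof. by rewrite /sqmod/=; ring. Qed.

Definition sqnorm n (v : 'cV[R[i]]_n) : R := \sum_k sqmod (v k 0).

Lemma sqnorm_ge0 n (v : 'cV[R[i]]_n) : 0 <= sqnorm v.
Proof. by apply: sumr_ge0 => k _; exact: sqmod_ge0. Qed.

Lemma sqnormE n (v : 'cV[R[i]]_n) : (sqnorm v)%:C = (v ^t* *m v) 0 0.
Proof.
rewrite !mxE rmorph_sum; apply: eq_bigr => k _.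
by rewrite !mxE /= sqmodE.
Qed.

Lemma sqnorm_eq0 n (v : 'cV[R[i]]_n) : sqnorm v = 0 -> v = 0.
Proof.
move=> /eqP; rewrite psumr_eq0 => [/allP v0|k _]; last exact: sqmod_ge0.
apply/colP => k; rewrite mxE; apply: sqmod_eq0.
by apply/eqP; apply: (v0 k); rewrite mem_index_enum.
Qed.

Definition contractive n (M : 'M[R[i]]_n) : Prop :=
  forall v : 'cV[R[i]]_n, sqnorm (M *m v) <= sqnorm v.

Lemma sqnorm_mulmx n (M : 'M[R[i]]_n) v :
  (sqnorm (M *m v))%:C = (v ^t* *m ((map_mx conjc M)^T *m M) *m v) 0 0.
Proof.
rewrite sqnormE; congr (_ _ 0 0).
by rewrite trmx_mul map_mxM !mulmxA map_trmx.
Qed.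

(** The spectral theorem for the Hermitian matrix M^* M, in the form of the
    simultaneous diagonalization of |v|^2 and |M v|^2.  An eigenvalue is real
    and nonnegative because it is |M v|^2 at a unit eigenvector v. *)
Lemma sqnorm_diagonalization n (M : 'M[R[i]]_n) :
  exists d : 'I_n -> R,
    [/\ forall k, 0 <= d k,
        forall k, eigenvalue ((map_mx conjc M)^T *m M) (d k)%:C &
        forall v, exists2 w : 'cV[R[i]]_n, sqnorm w = sqnorm v &
          sqnorm (M *m v) = \sum_k d k * sqmod (w k 0)].
Proof.
set H := (map_mx conjc M)^T *m M.
have HH : H ^t* = H.
  rewrite /H trmx_mul map_mxM trmxK -map_trmx; congr (_ *m _).
  by apply/matrixP => k r; rewrite !mxE; exact: conjcK.
have /orthomx_spectralP : H \is normalmx by apply/normalmxP; rewrite HH.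
set P := spectralmx H; set D := spectral_diag H => HE.
have Pu : P \is unitarymx by exact: spectral_unitarymx.
have PPK : P *m P ^t* = 1%:M by exact/unitarymxP.
have PKP : P ^t* *m P = 1%:M by rewrite -invmx_unitary// mulVmx// unitarymx_unit.
rewrite invmx_unitary// in HE.
have Pn (v : 'cV_n) : sqnorm (P *m v) = sqnorm v.
  apply: complexI; rewrite !sqnormE trmx_mul map_mxM -mulmxA (mulmxA _ P).
  by rewrite PKP mul1mx.
have Mn (v : 'cV_n) : (sqnorm (M *m v))%:C = \sum_k D 0 k * (sqmod ((P *m v) k 0))%:C.
  rewrite sqnorm_mulmx -/H HE !mulmxA.
  rewrite -(mulmxA _ P v) -map_mxM -trmx_mul mul_mx_diag !mxE; apply: eq_bigr => k _.
  rewrite !mxE /= sqmodE; ring.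
have DE k : D 0 k = (sqnorm (M *m (P ^t* *m delta_mx k 0)))%:C.
  rewrite Mn mulmxA PPK mul1mx (bigD1 k)//= big1 ?addr0.
    by rewrite !mxE !eqxx sqmod1 mulr1.
  by move=> m mk; rewrite !mxE (negbTE mk) sqmod0 mulr0.
exists (fun k => sqnorm (M *m (P ^t* *m delta_mx k 0))); split.
- by move=> k; exact: sqnorm_ge0.
- move=> k; rewrite -DE; apply/eigenvalueP; exists (delta_mx 0 k *m P).
    rewrite HE !mulmxA -(mulmxA _ P) PPK mulmx1 scalemxAl; congr (_ *m P).
    apply/rowP => m; rewrite mul_mx_diag !mxE.
    rewrite eqxx /=; have [->|_] := eqVneq m k; first by rewrite mulrC.
    by rewrite mul0r mulr0.
  apply/eqP => /(congr1 (mulmx^~ (P ^t*))); rewrite -mulmxA PPK mulmx1 mul0mx.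
  by move=> /rowP /(_ k) /eqP; rewrite !mxE !eqxx oner_eq0.
- move=> v; exists (P *m v) => //; apply: complexI.
  rewrite Mn rmorph_sum; apply: eq_bigr => k _.
  by rewrite DE rmorphM.
Qed.

(** Eigenvectors are row vectors; the conjugate transpose of one of M^* M is
    the vector that M stretches by the square root of the eigenvalue. *)
Lemma eigenvalue_sqnorm n (M : 'M[R[i]]_n) (a : R) :
  eigenvalue ((map_mx conjc M)^T *m M) a%:C ->
  exists2 v : 'cV[R[i]]_n, v != 0 & sqnorm (M *m v) = a * sqnorm v.
Proof.
move=> /eigenvalueP[u uE u0]; exists (u ^t*).
  apply: contra u0 => /eqP /(congr1 (fun v => v ^t*)).
  by rewrite trmxCK trmx0 map_mx0 => ->.
apply: complexI; rewrite sqnorm_mulmx trmxCK uE -scalemxAl mxE.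
by rewrite rmorphM/= sqnormE trmxCK.
Qed.

(** The squares of the singular values are bounded by the sum of the eigenvalues
    of M^* M, so that the supremum defining the largest one bounds them all. *)
Lemma Kinfty_complexE n (M : 'M[R[i]]_n) : Kinfty_complex M <-> contractive M.
Proof.
have [d [d0 dev dM]] := sqnorm_diagonalization M.
split=> [M1|cM].
- have sd1 m : d m <= 1.
    have ubS : has_ubound (singular_values_complex M).
      exists (1 + \sum_k d k) => s [s0 /eigenvalue_sqnorm[v v0]].
      have [w wv ->] := dM v => sv.
      have v_gt0 : 0 < sqnorm v.
        rewrite lt_neqAle sqnorm_ge0 andbT eq_sym.
        by apply: contra v0 => /eqP/sqnorm_eq0 ->.
      have : s ^+ 2 * sqnorm v <= (\sum_k d k) * sqnorm v.
        rewrite -sv -wv mulr_suml; apply: ler_sum => k _.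
        rewrite ler_wpM2l// /sqnorm (bigD1 k)//= lerDl.
        by apply: sumr_ge0 => p _; exact: sqmod_ge0.
      (* If 0 <= s and s^2 <= t then s <= 2 s <= 1 + s^2 <= 1 + t. *)
      rewrite ler_pM2r// => sd.
      have : 0 <= (s - 1) ^+ 2 by exact: sqr_ge0.
      by move: sd s0; set t := \sum_k _; nra.
    have Sk : singular_values_complex M (Num.sqrt (d m)).
      by split; rewrite ?sqrtr_ge0// sqr_sqrtr.
    have : Num.sqrt (d m) <= 1 by rewrite (le_trans _ M1)//; exact: ub_le_sup.
    by rewrite -[X in _ <= X]sqrtr1 ler_sqrt.
  move=> v; have [w <- ->] := dM v; apply: ler_sum => k _.
  by rewrite ler_piMl// sqmod_ge0.
- rewrite /Kinfty_complex /= /smax_complex.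
  have [->|S0] := eqVneq (singular_values_complex M) set0.
    by rewrite sup0 ler01.
  apply: ge_sup; first exact/set0P.
  move=> s [s0 /eigenvalue_sqnorm[v v0 sv]].
  have v_gt0 : 0 < sqnorm v.
    rewrite lt_neqAle sqnorm_ge0 andbT eq_sym.
    by apply: contra v0 => /eqP/sqnorm_eq0 ->.
  have := cM v; rewrite sv ger_pMl// => s1.
  by rewrite -(@ler_pXn2r _ 2)// ?nnegrE// expr1n.
Qed.

(** A real matrix has the same singular values as its complexification, since
    having a given eigenvalue is invariant under field extension. *)
Lemma Kinfty_realE n (M : 'M[R]_n) :
  Kinfty_real M <-> contractive (map_mx (real_complex R) M).
Proof.
rewrite -Kinfty_complexE /Kinfty_real /Kinfty_complex /smax_real /smax_complex /=.
suff -> : singular_values_complex (map_mx (real_complex R) M) =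
  singular_values_real M by [].
rewrite /singular_values_complex /singular_values_real.
apply/funext => s /=; congr (_ /\ is_true _).
have -> : map_mx conjc (map_mx (real_complex R) M) = map_mx (real_complex R) M.
  by apply/matrixP => k r; rewrite !mxE conjc_real.
by rewrite map_trmx -map_mxM eigenvalue_map.
Qed.

Lemma contraction_entry n (M : 'M[R[i]]_n) k r :
  contractive M -> sqmod (M k r) <= 1.
Proof.
move=> /(_ (delta_mx r 0)); have -> : sqnorm (delta_mx r 0) = 1.
  rewrite /sqnorm (bigD1 r)//= big1 ?addr0; first by rewrite mxE !eqxx sqmod1.
  by move=> m mr; rewrite mxE (negbTE mr) sqmod0.
apply: le_trans; rewrite -colE /sqnorm (bigD1 k)//= mxE lerDl.
by apply: sumr_ge0 => m _; exact: sqmod_ge0.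
Qed.

End contraction.

(** * Slices of the ball over one entry, and measurability of the ball *)

Section slice.
Context (R : realType) (n : nat).
Local Open Scope complex_scope.

(** The matrix (x, s; s, - conj x) is unitary. *)
Lemma julia_rotation (x p Y : R[i]) (s : R) : s ^+ 2 = 1 - sqmod x ->
  sqmod (x * p + s%:C * Y) + sqmod (s%:C * p - x^* * Y) = sqmod p + sqmod Y.
Proof.
case: x p Y => [x1 x2] [p1 p2] [y1 y2]; rewrite /sqmod /= => s2.
transitivity ((s ^+ 2 + x1 ^+ 2 + x2 ^+ 2) *
  (p1 ^+ 2 + p2 ^+ 2 + (y1 ^+ 2 + y2 ^+ 2))); first by ring.
by rewrite s2; ring.
Qed.

Variables (M N M0 : 'M[R[i]]_n) (i j : 'I_n) (s : R).
Hypothesis s_gt0 : 0 < s.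
Hypothesis s2 : s ^+ 2 = 1 - sqmod (M i j).
Hypothesis M0E : forall k r,
  M0 k r = if (k == i) && (r == j) then 0 else M k r.
Hypothesis NE : forall k r, N k r =
  if k == i then if r == j then M i j else s%:C * M i r
  else if r == j then s%:C * M k j else M k r - (M i j)^* * M k j * M i r.

Let feedback (v : 'cV[R[i]]_n) : R[i] := \sum_(r | r != j) M i r * v r 0.

(** The energy lost by N on v is the energy lost by M0 on v', where v' is v
    with the j-th coordinate replaced by the second output of the rotation. *)
Let defect (v v' : 'cV[R[i]]_n) :
  (forall r, r != j -> v' r 0 = v r 0) ->
  v' j 0 = s%:C * v j 0 - (M i j)^* * feedback v ->
  sqnorm v - sqnorm (N *m v) = sqnorm v' - sqnorm (M0 *m v').
Proof.
move=> v'v v'j; have Nk k : k != i -> (N *m v) k 0 = (M0 *m v') k 0.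
  move=> ki; rewrite !mxE (bigD1 j)//= [RHS](bigD1 j)//=.
  rewrite NE M0E (negbTE ki) eqxx/= v'j mulrBr mulr_sumr mulr_sumr.
  rewrite mulrA (mulrC (M k j)) -[RHS]addrA; congr (_ + _).
  rewrite -sumrN -big_split/=; apply: eq_bigr => r rj.
  by rewrite NE M0E (negbTE ki) (negbTE rj)/= v'v//; ring.
have Ni : (N *m v) i 0 = M i j * v j 0 + s%:C * feedback v.
  rewrite !mxE (bigD1 j)//= NE !eqxx; congr (_ + _).
  rewrite mulr_sumr; apply: eq_bigr => r rj.
  by rewrite NE eqxx (negbTE rj); ring.
have M0i : (M0 *m v') i 0 = feedback v.
  rewrite !mxE (bigD1 j)//= M0E !eqxx mul0r add0r.
  by apply: eq_bigr => r rj; rewrite M0E eqxx (negbTE rj)/= v'v.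
rewrite /sqnorm (bigD1 j)//= [X in _ - X](bigD1 i)//= [in RHS](bigD1 j)//=.
rewrite [X in _ = _ - X](bigD1 i)//= Ni M0i v'j.
rewrite (eq_bigr (fun k => sqmod (v k 0)) (P := fun k => k != j)
  (F1 := fun k => sqmod (v' k 0))); last first.
  by move=> r rj; rewrite v'v.
rewrite (eq_bigr (fun k => sqmod ((M0 *m v') k 0)) (P := fun k => k != i)
  (F1 := fun k => sqmod ((N *m v) k 0))); last first.
  by move=> k ki; rewrite Nk.
have := julia_rotation (v j 0) (feedback v) s2.
set a := sqmod _; set b := sqmod _; set c := sqmod _; set d := sqmod _.
move=> E; have -> : b = c + d - a by rewrite -E addrAC subrr add0r.
ring.
Qed.

(** Since s > 0, the correspondence between v and v' is a bijection. *)
Lemma contraction_slice : contractive N <-> contractive M0.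
Proof.
split=> cM v; rewrite -subr_ge0.
- pose w : 'cV[R[i]]_n := \col_r if r == j
    then s%:C^-1 * (v j 0 + (M i j)^* * feedback v) else v r 0.
  have wv r : r != j -> w r 0 = v r 0 by move=> rj; rewrite mxE (negbTE rj).
  have fw : feedback w = feedback v.
    by apply: eq_bigr => r rj; rewrite wv.
  rewrite -(@defect w); first by rewrite subr_ge0.
  - by move=> r rj; rewrite wv.
  - rewrite fw mxE eqxx mulVKf ?addrK//.
    by apply/eqP => -[/eqP]; rewrite gt_eqF.
- rewrite (@defect v (\col_r if r == j then s%:C * v j 0 - (M i j)^* * feedback v
    else v r 0)); first by rewrite subr_ge0.
  - by move=> r rj; rewrite mxE (negbTE rj).
  - by rewrite mxE eqxx.
Qed.

End slice.

Section measurable_contraction.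
Context (R : realType) (n : nat).
Local Open Scope complex_scope.

Lemma rat_approximation (t : R) :
  {q : nat -> rat | (ratr (q m) : R) @[m --> \oo] --> t}.
Proof.
have H m : {q : rat | ratr q \in `]t, t + m.+1%:R^-1[}.
  by apply: cid; apply: rat_in_itvoo; rewrite ltrDl invr_gt0.
exists (fun m => sval (H m)).
apply: (@squeeze_cvgr _ _ _ _ (fun _ => t) (fun m => t + m.+1%:R^-1)).
- apply: nearW => m; have := svalP (H m).
  by rewrite in_itv /= => /andP[/ltW -> /ltW ->].
- exact: cvg_cst.
- rewrite -[X in _ --> X]addr0; apply: cvgD; first exact: cvg_cst.
  exact: cvg_harmonic.
Qed.

Lemma cvg_sqnorm (u : nat -> 'cV[R[i]]_n) (v : 'cV[R[i]]_n) :
  (forall k, complex.Re (u m k 0) @[m --> \oo] --> complex.Re (v k 0)) ->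
  (forall k, complex.Im (u m k 0) @[m --> \oo] --> complex.Im (v k 0)) ->
  sqnorm (u m) @[m --> \oo] --> sqnorm v.
Proof.
move=> cR cI; apply: cvg_big => [|k _].
  exact: add_continuous.
by apply: cvgD; apply: cvgM.
Qed.

Lemma Re_mulmx (M : 'M[R[i]]_n) (v : 'cV[R[i]]_n) k : complex.Re ((M *m v) k 0) =
  \sum_r (complex.Re (M k r) * complex.Re (v r 0) -
          complex.Im (M k r) * complex.Im (v r 0)).
Proof.
rewrite mxE (raddf_sum (@complex.Re R)).
by apply: eq_bigr => r _; case: (M k r) (v r 0) => [a b] [c d].
Qed.

Lemma Im_mulmx (M : 'M[R[i]]_n) (v : 'cV[R[i]]_n) k : complex.Im ((M *m v) k 0) =
  \sum_r (complex.Re (M k r) * complex.Im (v r 0) +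
          complex.Im (M k r) * complex.Re (v r 0)).
Proof.
rewrite mxE (raddf_sum (@complex.Im R)).
by apply: eq_bigr => r _; case: (M k r) (v r 0) => [a b] [c d].
Qed.

Definition gaussian_col (q : 'cV[rat * rat]_n) : 'cV[R[i]]_n :=
  \col_k (ratr (q k 0).1 +i* ratr (q k 0).2).

(** Contractivity needs to be tested on countably many vectors only, which is
    what makes the ball measurable. *)
Lemma contraction_gaussian (M : 'M[R[i]]_n) : contractive M <->
  forall q, sqnorm (M *m gaussian_col q) <= sqnorm (gaussian_col q).
Proof.
split=> [cM q|cM v]; first exact: cM.
pose qr k := rat_approximation (complex.Re (v k 0)).
pose qi k := rat_approximation (complex.Im (v k 0)).
pose u m := gaussian_col (\col_k (sval (qr k) m, sval (qi k) m)).
have uR k : complex.Re (u m k 0) @[m --> \oo] --> complex.Re (v k 0).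
  by under eq_fun do rewrite !mxE/=; exact: (svalP (qr k)).
have uI k : complex.Im (u m k 0) @[m --> \oo] --> complex.Im (v k 0).
  by under eq_fun do rewrite !mxE/=; exact: (svalP (qi k)).
have cMu : sqnorm (M *m u m) @[m --> \oo] --> sqnorm (M *m v).
  apply: cvg_sqnorm => k.
    rewrite Re_mulmx; under eq_fun do rewrite Re_mulmx.
    apply: cvg_big => [|r _]; first exact: add_continuous.
    by apply: cvgB; apply: cvgM => //; exact: cvg_cst.
  rewrite Im_mulmx; under eq_fun do rewrite Im_mulmx.
  apply: cvg_big => [|r _]; first exact: add_continuous.
  by apply: cvgD; apply: cvgM => //; exact: cvg_cst.
apply: (ler_cvg_to cMu (cvg_sqnorm uR uI)).
by apply: nearW => m; exact: cM.
Qed.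

Lemma measurable_contraction d (X : measurableType d) (f : X -> 'M[R[i]]_n) :
  (forall k r, measurable_fun setT (fun x => complex.Re (f x k r))) ->
  (forall k r, measurable_fun setT (fun x => complex.Im (f x k r))) ->
  measurable [set x | contractive (f x)].
Proof.
move=> mR mI.
have -> : [set x | contractive (f x)] = \bigcap_(m : nat)
  [set x | if @unpickle 'cV[rat * rat]_n m is Some q
    then sqnorm (f x *m gaussian_col q) <= sqnorm (gaussian_col q) else true].
  apply/seteqP; split=> x /=.
    by move=> /contraction_gaussian cf m _ /=; case: unpickle.
  move=> H; apply/contraction_gaussian => q.
  by have := H (pickle q) I; rewrite /= pickleK.
apply: bigcapT_measurable => m; case: unpickle => [q|]; last first.
  by rewrite (_ : mkset _ = setT)//; apply/seteqP.
rewrite -[X in measurable X]setTI.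
apply: measurable_fun_le; [exact: measurableT| |exact: measurable_cst].
apply: measurable_sum => k; apply: measurable_funD; apply: measurable_funX.
    under eq_fun do rewrite Re_mulmx; apply: measurable_sum => r.
    by apply: measurable_funB; apply: measurable_funM.
  under eq_fun do rewrite Im_mulmx; apply: measurable_sum => r.
  by apply: measurable_funD; apply: measurable_funM.
Qed.

End measurable_contraction.

(** * Fubini for a single entry of a matrix *)

Definition set_entry (T : Type) m n (M : 'M[T]_(m, n)) (e : 'I_m * 'I_n) (x : T) :
  'M[T]_(m, n) := \matrix_(k, r) if (k, r) == e then x else M k r.

Section matrix_fubini.
Context d (T : measurableType d) (R : realType) (m n : nat).
Variable mu : {sigma_finite_measure set T -> \bar R}.
Local Notation mp := (matrix_power mu (m := m) (n := n)).
Local Notation "''MT'" := ('M[T]_(m, n)) (at level 0).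
Local Open Scope ereal_scope.

Let mx_of_tuples (t : m.-tuple (n.-tuple T)) : 'MT :=
  (\matrix_(i < m, j < n) tnth (tnth t i) j)%R.

Let tuples_of_mx (M : 'MT) : m.-tuple (n.-tuple T) :=
  [tuple [tuple M i j | j < n] | i < m].

Let mx_of_tuplesK : cancel mx_of_tuples tuples_of_mx.
Proof.
move=> t; apply: eq_from_tnth => i; rewrite tnth_mktuple.
by apply: eq_from_tnth => j; rewrite tnth_mktuple mxE.
Qed.

Let measurable_tuples_of_mx : measurable_fun setT tuples_of_mx.
Proof.
apply/measurable_fun_tnthP => i; apply/measurable_fun_tnthP => j.
rewrite (_ : _ \o _ = (fun M : 'MT => M i j)); first exact: measurable_entry.
by apply/funext => M /=; rewrite !tnth_mktuple.
Qed.

Let matrix_power_sigma_finite : sigma_finite setT mp.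
Proof.
exact: (pushforward_sigma_finite measurable_tuples_of_mx mx_of_tuplesK
  (sigma_finiteT (tuple_power (tuple_power mu (k := n)) (k := m)))).
Qed.

(* Needed to form products with the measure on matrices. *)
HB.instance Definition _ := Measure_isSigmaFinite.Build _ _ _ mp
  matrix_power_sigma_finite.

Definition swap_entry (e : 'I_m * 'I_n) (p : T * 'MT) : T * 'MT :=
  (p.2 e.1 e.2, set_entry p.2 e p.1).

Lemma measurable_set_entry e :
  measurable_fun setT (fun p : T * 'MT => set_entry p.2 e p.1).
Proof.
apply: measurable_fun_matrix => i j; under eq_fun do rewrite mxE.
case: (_ == e); first exact: measurable_fst.
apply: (@measurableT_comp _ _ _ _ _ _ (fun M : 'MT => M i j)) => //.
exact: measurable_entry.
Qed.

Lemma measurable_swap_entry e : measurable_fun setT (swap_entry e).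
Proof.
apply: measurable_fun_pair; last exact: measurable_set_entry.
apply: (@measurableT_comp _ _ _ _ _ _ (fun M : 'MT => M e.1 e.2)) => //.
exact: measurable_entry.
Qed.

Definition mx_box (B : 'I_m -> 'I_n -> set T) : set 'MT :=
  [set M | forall i j, B i j (M i j)].

Let prod_box : set (set (T * 'MT)) := [set C | exists A B,
  [/\ measurable A, forall i j, measurable (B i j) & C = A `*` mx_box B]].

Lemma measurable_mx_box (B : 'I_m -> 'I_n -> set T) :
  (forall i j, measurable (B i j)) -> measurable (mx_box B).
Proof.
move=> mB; rewrite (_ : mx_box B = \bigcap_(e in [set: 'I_m * 'I_n])
    ((fun M : 'MT => M e.1 e.2) @^-1` B e.1 e.2)); last first.
  by apply/seteqP; split=> [M BM [i j] _|M BM i j]; [exact: BM|exact: (BM (i, j))].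
apply: fin_bigcap_measurable; first exact: finite_finset.
by move=> e _; rewrite -[X in measurable X]setTI; exact: measurable_entry.
Qed.

(** Products of boxes generate: the identity is measurable out of the
    sigma-algebra that they generate, coordinate by coordinate. *)
Let measurable_prod_box : @measurable _ (T * 'MT)%type = <<s prod_box >>.
Proof.
apply/seteqP; split; last first.
  apply: smallest_sub; first exact: sigma_algebra_measurable.
  move=> _ [A [B [mA mB ->]]].
  by apply: measurableX => //; exact: measurable_mx_box.
pose X : measurableType _ := g_sigma_algebraType prod_box.
have mid : measurable_fun (setT : set X) (id : X -> T * 'MT).
  apply/measurable_fun_pairP; split.
    move=> _ A mA; rewrite setTI; apply: sub_sigma_algebra.
    exists A, (fun _ _ => setT); split => //.
    by apply/seteqP; split => // p [].
  apply: measurable_fun_matrix => i j _ A mA; rewrite setTI.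
  apply: sub_sigma_algebra.
  exists setT, (fun k r => if (k, r) == (i, j) then A else setT); split => //.
    by move=> k r; case: ifP.
  apply/seteqP; split=> p /=; last by move=> [_ /(_ i j)]; rewrite eqxx.
  by move=> Ap; split => // k r; case: eqP => // -[-> ->].
by move=> A mA; have := mid measurableT A mA; rewrite setTI.
Qed.

Lemma product_matrix_power_box A (B : 'I_m -> 'I_n -> set T) :
  measurable A -> (forall i j, measurable (B i j)) ->
  (mu \x mp) (A `*` mx_box B) = mu A * \prod_(e : 'I_m * 'I_n) mu (B e.1 e.2).
Proof.
move=> mA mB; rewrite product_measure1E//; last exact: measurable_mx_box.
by congr (_ * _); rewrite -(pair_bigA _ (fun k r => mu (B k r))); exact: matrix_power_box.
Qed.

Lemma swap_entry_box e A (B : 'I_m -> 'I_n -> set T) :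
  swap_entry e @^-1` (A `*` mx_box B) =
  B e.1 e.2 `*` mx_box (fun k r => if (k, r) == e then A else B k r).
Proof.
case: e => i j; apply/seteqP; split=> -[x M] /= [AM BM]; split.
- by have := BM i j; rewrite mxE eqxx.
- move=> k r; case: eqP => [[-> ->]//|/eqP/negbTE kr].
  by have := BM k r; rewrite mxE kr.
- by have := BM i j; rewrite eqxx.
- move=> k r; rewrite mxE; case: eqP => [[-> ->]//|/eqP/negbTE kr].
  by have := BM k r; rewrite kr.
Qed.

(** Both measures agree on boxes, where the exchange permutes two factors of
    a product; boxes are stable under intersection and a sequence of boxes of
    finite measure covers the space. *)
Lemma swap_entry_invariant e X : measurable X ->
  (mu \x mp) (swap_entry e @^-1` X) = (mu \x mp) X.
Proof.
move=> mX; have /sigma_finiteP[F [TF ndF Foo]] := sigma_finiteT mu.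
pose q : {measure set (T * 'MT) -> \bar R} :=
  measure_function_pushforward__canonical__measure_function_Measure
    (mu \x mp) (measurable_swap_entry e).
rewrite -[LHS]/(q X).
pose FB k : set (T * 'MT) := F k `*` mx_box (fun _ _ => F k).
have mF k : measurable (F k) by have [] := Foo k.
apply/esym/(measure_unique prod_box FB) => //.
- move=> _ _ [A [B [mA mB ->]]] [A' [B' [mA' mB' ->]]].
  exists (A `&` A'), (fun i j => B i j `&` B' i j); split.
  + exact: measurableI.
  + by move=> i j; exact: measurableI.
  + rewrite -setXI; congr (_ `*` _).
    apply/seteqP; split=> M /=; first by move=> [BM BM'] i j.
    by move=> BM; split=> i j; have [] := BM i j.
- by move=> k; exists (F k), (fun _ _ => F k).
- rewrite predeqE => -[x M]; split => // _.
  have /choice[N FN] : forall y, exists k, F k y.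
    by move=> y; have : setT y by []; rewrite TF => -[k _ Fky]; exists k.
  (* An index beyond those of x and of all entries of M. *)
  pose K := (N x + \sum_(p : 'I_m * 'I_n) N (M p.1 p.2))%N.
  have FK y : (N y <= K)%N -> F K y.
    by move=> yK; move: (FN y); apply/subsetPset/ndF.
  exists K => //; split => /=; first by apply: FK; rewrite leq_addr.
  move=> i j; apply: FK; rewrite /K (bigD1 (i, j))//=.
  by rewrite addnCA leq_addr.
- move=> _ [A [B [mA mB ->]]].
  rewrite -[RHS]/((mu \x mp) (swap_entry e @^-1` (A `*` mx_box B))).
  rewrite swap_entry_box.
  transitivity (mu A * \prod_(f : 'I_m * 'I_n) mu (B f.1 f.2)).
    exact: product_matrix_power_box.
  rewrite [RHS]product_matrix_power_box//; last by move=> i j; case: ifP.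
  rewrite (bigD1 e)//= [in RHS](bigD1 e)//= -surjective_pairing eqxx !muleA.
  rewrite (muleC (mu A)); congr (_ * _).
  by apply: eq_bigr => f; rewrite -surjective_pairing => /negbTE ->.
- move=> k; rewrite [X in X < _](product_matrix_power_box (mF k) (fun _ _ => mF k)).
  have [mFk Fkoo] := Foo k.
  have fFk : mu (F k) \is a fin_num by rewrite ge0_fin_numE.
  rewrite ltey_eq fin_numM//.
  by elim/big_ind : _ => // y z; exact: fin_numM.
Qed.

(** The entry at e is integrated out inside the space of all matrices: an extra
    scalar, distributed on a set B of mass 1, is adjoined and then exchanged
    with that entry. *)
Lemma entry_fubini (B : set T) e (F : 'MT -> \bar R) :
  measurable B -> mu B = 1 -> measurable_fun setT F -> (forall M, 0 <= F M) ->
  \int[mp]_M F M =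
  \int[mp]_M \int[mu]_x ((\1_B (M e.1 e.2))%:E * F (set_entry M e x)).
Proof.
move=> mB B1 mF F0.
pose G (p : T * 'MT) := (\1_B p.1)%:E * F p.2.
have mG : measurable_fun setT G.
  apply: emeasurable_funM; last exact: measurableT_comp.
  by apply/measurable_EFinP; apply: measurableT_comp => //; exact: measurable_indic.
have G0 p : 0 <= G p by rewrite mule_ge0// lee_fin indicE.
transitivity (\int[mu \x mp]_p G p).
  rewrite fubini_tonelli2//=; apply: eq_integral => M _.
  rewrite /fubini_G /G /= ge0_integralZr//.
  - by rewrite integral_indic// setIT B1 mul1e.
  - by apply/measurable_EFinP; exact: measurable_indic.
transitivity (\int[mu \x mp]_p G (swap_entry e p)).
  transitivity (\int[pushforward (mu \x mp) (swap_entry e)]_p G p).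
    apply: eq_measure_integral; first exact: measurable_swap_entry.
    by move=> ms A mA _; apply/esym; exact: swap_entry_invariant.
  by rewrite ge0_integral_pushforward//; exact: measurable_swap_entry.
rewrite (fubini_tonelli2 (G \o swap_entry e))//=.
- by apply: measurableT_comp => //; exact: measurable_swap_entry.
Qed.

End matrix_fubini.

(** * Entrywise affine changes of variables *)

(** What the argument uses of the scalar field and its Lebesgue measure, all
    algebra being transported to the complex numbers by toC.  The operation
    affT s c x stands for s x + c, tripleT x z y for - conj x z y, and dimT
    is the real dimension.  The sigma-algebra is the one generated by the real
    and imaginary parts of toC ([measurable_of_toC]). *)
Record scalar_model d (T : measurableType d) (R : realType)
    (mu : {measure set T -> \bar R}) := ScalarModel {
  toC : T -> R[i];
  measurable_Re_toC : measurable_fun setT (fun x => complex.Re (toC x));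
  measurable_Im_toC : measurable_fun setT (fun x => complex.Im (toC x));
  measurable_of_toC : forall d' (X : measurableType d') (f : X -> T),
    measurable_fun setT (fun x => complex.Re (toC (f x))) ->
    measurable_fun setT (fun x => complex.Im (toC (f x))) ->
    measurable_fun setT f;
  zeroT : T;
  toC_zero : toC zeroT = 0;
  oppT : T -> T;
  toC_opp : forall x, toC (oppT x) = - toC x;
  affT : R -> T -> T -> T;
  toC_aff : forall s c x, toC (affT s c x) = (s%:C)%C * toC x + toC c;
  tripleT : T -> T -> T -> T;
  toC_triple : forall x z y,
    toC (tripleT x z y) = - ((conjc (toC x)) * toC z * toC y);
  dimT : nat;
  integral_affT : forall (s : R) (c : T) (g : T -> \bar R), 0 < s ->
    measurable_fun setT g -> (forall x, (0 <= g x)%E) ->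
    (\int[mu]_x g x = \int[mu]_x ((s ^+ dimT)%:E * g (affT s c x)))%E;
  integral_oppT : forall (g : T -> \bar R),
    measurable_fun setT g -> (forall x, (0 <= g x)%E) ->
    (\int[mu]_x g x = \int[mu]_x g (oppT x))%E;
  unit_mass : exists2 B : set T, measurable B & mu B = 1%E;
  unit_circle_null : mu [set x | sqmod (toC x) = 1] = 0%E }.

Section set_entry_theory.
Context (T : Type) (m n : nat).
Implicit Types (M : 'M[T]_(m, n)) (e : 'I_m * 'I_n).

Lemma set_entryE M e x k r :
  set_entry M e x k r = if (k, r) == e then x else M k r.
Proof. by rewrite mxE. Qed.

Lemma set_entry_same M e x : set_entry M e x e.1 e.2 = x.
Proof. by rewrite set_entryE -surjective_pairing eqxx. Qed.

Lemma set_entry_twice M e x y : set_entry (set_entry M e x) e y = set_entry M e y.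
Proof. by apply/matrixP => k r; rewrite !set_entryE; case: (_ == e). Qed.

End set_entry_theory.

Section affine_change.
Context d (T : measurableType d) (R : realType) (m n : nat).
Variables (mu : {sigma_finite_measure set T -> \bar R}) (S : scalar_model mu).
Local Notation mp := (matrix_power mu (m := m) (n := n)).
Local Notation "''MT'" := ('M[T]_(m, n)) (at level 0).
Local Open Scope ereal_scope.

Lemma measurable_affT d' (X : measurableType d') (s : X -> R) (c x : X -> T) :
  measurable_fun setT s -> measurable_fun setT c -> measurable_fun setT x ->
  measurable_fun setT (fun t => affT S (s t) (c t) (x t)).
Proof.
move=> ms mc mx.
have mR (f : X -> T) : measurable_fun setT f ->
    measurable_fun setT (fun t => complex.Re (toC S (f t))).
  by move=> mf; apply: (measurableT_comp (measurable_Re_toC S)).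
have mI (f : X -> T) : measurable_fun setT f ->
    measurable_fun setT (fun t => complex.Im (toC S (f t))).
  by move=> mf; apply: (measurableT_comp (measurable_Im_toC S)).
apply: (@measurable_of_toC _ _ _ _ S).
- rewrite (_ : (fun t => _) = (fun t => s t * complex.Re (toC S (x t)) +
      complex.Re (toC S (c t)))%R).
    by apply: measurable_funD; [apply: measurable_funM => //|]; exact: mR.
  apply/funext => t; rewrite toC_aff.
  by case: (toC S (x t)) (toC S (c t)) => [a b] [u v] /=; ring.
- rewrite (_ : (fun t => _) = (fun t => s t * complex.Im (toC S (x t)) +
      complex.Im (toC S (c t)))%R).
    by apply: measurable_funD; [apply: measurable_funM => //|]; exact: mI.
  apply/funext => t; rewrite toC_aff.
  by case: (toC S (x t)) (toC S (c t)) => [a b] [u v] /=; ring.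
Qed.

Lemma measurable_set_entry_val (M : 'MT) e :
  measurable_fun setT (fun x : T => set_entry M e x).
Proof.
apply: (measurableT_comp (measurable_set_entry (m := m) (n := n) e)
  (g := fun x : T => (x, M))).
exact: pair2_measurable.
Qed.

(** By Fubini for the entry at e, the one-variable formula applies while the
    coefficients, independent of that entry, are constant. *)
Lemma integral_affine_entry e (s : 'MT -> R) (c : 'MT -> T) (F : 'MT -> \bar R) :
  measurable_fun setT s -> measurable_fun setT c ->
  (forall M, 0 < s M)%R ->
  (forall M x, s (set_entry M e x) = s M) ->
  (forall M x, c (set_entry M e x) = c M) ->
  measurable_fun setT F -> (forall M, 0 <= F M) ->
  \int[mp]_M F M = \int[mp]_M ((s M ^+ dimT S)%:E *
     F (set_entry M e (affT S (s M) (c M) (M e.1 e.2)))).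
Proof.
move=> ms mc s0 sE cE mF F0; have [B mB B1] := unit_mass S.
have sn0 M : 0 <= (s M ^+ dimT S)%:E by rewrite lee_fin exprn_ge0// ltW.
have mG : measurable_fun setT (fun M : 'MT =>
    F (set_entry M e (affT S (s M) (c M) (M e.1 e.2)))).
  apply: (measurableT_comp mF).
  apply: (measurableT_comp (measurable_set_entry (m := m) (n := n) e)
    (g := fun M : 'MT => (affT S (s M) (c M) (M e.1 e.2), M))).
  apply: measurable_fun_pair => //.
  by apply: measurable_affT => //; exact: measurable_entry.
rewrite (@entry_fubini _ _ _ _ _ mu B e F)//.
rewrite [RHS](@entry_fubini _ _ _ _ _ mu B e)//; last 2 first.
- apply: emeasurable_funM => //; apply/measurable_EFinP.
  exact: measurable_funX.
- by move=> M; rewrite mule_ge0.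
apply: eq_integral => M _.
have mFM : measurable_fun setT (fun x => F (set_entry M e x)).
  exact: (measurableT_comp mF (measurable_set_entry_val _ _)).
rewrite ge0_integralZl//.
rewrite (integral_affT S (c M) (s0 M) mFM)// -ge0_integralZl//.
- by apply: eq_integral => x _; rewrite set_entry_same set_entry_twice sE cE.
- apply: emeasurable_funM; first exact: measurable_cst.
  apply: (measurableT_comp mFM).
  by apply: measurable_affT.
- by move=> x _; rewrite mule_ge0.
Qed.

Definition aff_entries (es : seq ('I_m * 'I_n)) (s : 'I_m * 'I_n -> 'MT -> R)
    (c : 'I_m * 'I_n -> 'MT -> T) (M : 'MT) : 'MT :=
  \matrix_(k, r) if (k, r) \in es
    then affT S (s (k, r) M) (c (k, r) M) (M k r) else M k r.

Lemma measurable_aff_entries (es : seq ('I_m * 'I_n))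
    (s : 'I_m * 'I_n -> 'MT -> R) (c : 'I_m * 'I_n -> 'MT -> T) :
  (forall e, measurable_fun setT (s e)) -> (forall e, measurable_fun setT (c e)) ->
  measurable_fun setT (aff_entries es s c).
Proof.
move=> ms mc; apply: measurable_fun_matrix => k r; under eq_fun do rewrite mxE.
case: (_ \in es); last exact: measurable_entry.
by apply: measurable_affT => //; exact: measurable_entry.
Qed.

(** The coefficients are independent of all the entries that are changed, so
    the simultaneous change is the composite of the successive ones. *)
Lemma integral_affine_entries (es : seq ('I_m * 'I_n))
    (s : 'I_m * 'I_n -> 'MT -> R) (c : 'I_m * 'I_n -> 'MT -> T)
    (F : 'MT -> \bar R) : uniq es ->
  (forall e, measurable_fun setT (s e)) -> (forall e, measurable_fun setT (c e)) ->
  (forall e M, 0 < s e M)%R ->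
  {in es &, forall e f M x, s e (set_entry M f x) = s e M} ->
  {in es &, forall e f M x, c e (set_entry M f x) = c e M} ->
  measurable_fun setT F -> (forall M, 0 <= F M) ->
  \int[mp]_M F M = \int[mp]_M ((\prod_(e <- es) s e M ^+ dimT S)%:E *
     F (aff_entries es s c M)).
Proof.
move=> ues ms mc s0 + + mF F0; elim: es ues => [|e es IH] /=.
  move=> _ _ _; apply: eq_integral => M _; rewrite big_nil mul1e; congr F.
  by apply/matrixP => k r; rewrite mxE.
move=> /andP[ees ues] sE cE.
have sub a : a \in es -> a \in e :: es by move=> aes; rewrite inE aes orbT.
have ie : e \in e :: es by rewrite mem_head.
rewrite IH//; last 2 first.
- by move=> a b aes bes; apply: sE; exact: sub.
- by move=> a b aes bes; apply: cE; exact: sub.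
have p0 M : (0 <= \prod_(a <- es) s a M ^+ dimT S)%R.
  by apply: prodr_ge0 => a _; rewrite exprn_ge0// ltW.
rewrite (@integral_affine_entry e (s e) (c e))//; last 4 first.
- by move=> M x; rewrite sE.
- by move=> M x; rewrite cE.
- apply: emeasurable_funM; last first.
    exact: (measurableT_comp mF (measurable_aff_entries _ ms mc)).
  apply/measurable_EFinP; apply: measurable_prod => a _.
  exact: measurable_funX.
- by move=> M; rewrite mule_ge0// lee_fin.
apply: eq_integral => M _; rewrite big_cons EFinM -muleA; congr (_ * (_ * F _)).
  by congr EFin; apply: eq_big_seq => a aes; rewrite (sE _ _ (sub _ aes) ie).
apply/matrixP => k r; rewrite !mxE inE.
have [kre|kre] := eqVneq (k, r) e.
  by rewrite /= -kre (negbTE (_ : (k, r) \notin es))// kre.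
rewrite /=; case: ifP => // krs.
by rewrite (sE _ _ (sub _ krs) ie) (cE _ _ (sub _ krs) ie).
Qed.

End affine_change.

(** * Moments of two entries over the ball *)

Section ball_moments.
Context d (T : measurableType d) (R : realType) (n : nat).
Variables (mu : {sigma_finite_measure set T -> \bar R}) (S : scalar_model mu).
Variables (i l j r : 'I_n).
Hypotheses (il : i != l) (jr : j != r).
Local Notation mp := (matrix_power mu (m := n) (n := n)).
Local Notation "''MT'" := ('M[T]_n) (at level 0).

Definition sqabs (t : T) : R := sqmod (toC S t).

Lemma sqabs_ge0 t : 0 <= sqabs t. Proof. exact: sqmod_ge0. Qed.

Lemma measurable_sqabs : measurable_fun setT sqabs.
Proof.
apply: measurable_funD; apply: measurable_funX.
  exact: measurable_Re_toC.
exact: measurable_Im_toC.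
Qed.

Definition complex_mx (M : 'MT) : 'M[R[i]]_n := map_mx (toC S) M.

Definition model_ball : set 'MT := [set M | contractive (complex_mx M)].

(** The slice of the ball over the value 0 of the entry (i, j), viewed as a
    cylinder in the space of all matrices. *)
Definition pivot_ball : set 'MT :=
  [set M | contractive (complex_mx (set_entry M (i, j) (zeroT S)))].

Lemma measurable_model_ball : measurable model_ball.
Proof.
apply: measurable_contraction => k q; under eq_fun do rewrite mxE.
- by apply: (measurableT_comp (measurable_Re_toC S)); exact: measurable_entry.
- by apply: (measurableT_comp (measurable_Im_toC S)); exact: measurable_entry.
Qed.

Let measurable_pivot :
  measurable_fun setT (fun M : 'MT => set_entry M (i, j) (zeroT S)).
Proof.
apply: (measurableT_comp (measurable_set_entry (m := n) (n := n) (i, j))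
  (g := fun M : 'MT => (zeroT S, M))).
exact: pair1_measurable.
Qed.

Lemma measurable_pivot_ball : measurable pivot_ball.
Proof.
rewrite -[X in measurable X]setTI.
exact: (measurable_pivot measurableT measurable_model_ball).
Qed.

(** The number s = sqrt (1 - |x|^2), extended by 1 outside the unit disk in
    order to be positive everywhere. *)
Definition cosine (t : T) : R := if sqabs t < 1 then Num.sqrt (1 - sqabs t) else 1.

Lemma cosine_gt0 t : 0 < cosine t.
Proof. by rewrite /cosine; case: ifP => // t1; rewrite sqrtr_gt0 subr_gt0. Qed.

Lemma measurable_cosine : measurable_fun setT cosine.
Proof.
apply: measurable_fun_ifT.
- by apply: measurable_fun_ltr; [exact: measurable_sqabs|exact: measurable_cst].
- apply: (@measurableT_comp _ _ _ _ _ _ (@Num.sqrt R) _ (fun t => 1 - sqabs t)).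
    exact: continuous_measurable_fun (@sqrt_continuous R).
  by apply: measurable_funB; [exact: measurable_cst|exact: measurable_sqabs].
- exact: measurable_cst.
Qed.

Definition inner_entries : seq ('I_n * 'I_n) :=
  [seq e <- enum {: 'I_n * 'I_n} | (e.1 != i) && (e.2 != j)].
Definition cross_entries : seq ('I_n * 'I_n) :=
  [seq e <- enum {: 'I_n * 'I_n} | (e.1 == i) (+) (e.2 == j)].

Definition shear : 'MT -> 'MT := aff_entries S inner_entries (fun _ _ => 1)
  (fun e M => tripleT S (M i j) (M e.1 j) (M i e.2)).
Definition dilate : 'MT -> 'MT := aff_entries S cross_entries
  (fun _ M => cosine (M i j)) (fun _ _ => zeroT S).
(** Dilation and shear commute up to the factor s^2 in the shear: the shear
    comes first and uses the undilated y and z. *)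
Definition julia (M : 'MT) : 'MT := dilate (shear M).

Lemma mem_inner k q : ((k, q) \in inner_entries) = (k != i) && (q != j).
Proof. by rewrite mem_filter mem_enum inE andbT. Qed.

Lemma mem_cross k q : ((k, q) \in cross_entries) = (k == i) (+) (q == j).
Proof. by rewrite mem_filter mem_enum inE andbT. Qed.

Lemma toC_shear (M : 'MT) k q : toC S (shear M k q) =
  if (k != i) && (q != j) then
    toC S (M k q) - conjc (toC S (M i j)) * toC S (M k j) * toC S (M i q)
  else toC S (M k q).
Proof.
rewrite mxE mem_inner; case: ifP => // _.
by rewrite toC_aff toC_triple mul1r.
Qed.

Lemma toC_dilate (M : 'MT) k q : toC S (dilate M k q) =
  if (k == i) (+) (q == j) then ((cosine (M i j))%:C)%C * toC S (M k q)
  else toC S (M k q).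
Proof.
rewrite mxE mem_cross; case: ifP => // _.
by rewrite toC_aff toC_zero addr0.
Qed.

Lemma shear_pivot (M : 'MT) : shear M i j = M i j.
Proof. by rewrite mxE mem_inner eqxx. Qed.

Lemma julia_pivot (M : 'MT) : julia M i j = M i j.
Proof. by rewrite mxE mem_cross !eqxx shear_pivot. Qed.

Lemma toC_julia (M : 'MT) k q : complex_mx (julia M) k q =
  if k == i then if q == j then toC S (M i j)
    else ((cosine (M i j))%:C)%C * toC S (M i q)
  else if q == j then ((cosine (M i j))%:C)%C * toC S (M k j)
    else toC S (M k q) - conjc (toC S (M i j)) * toC S (M k j) * toC S (M i q).
Proof.
rewrite mxE toC_dilate !toC_shear shear_pivot.
by have [->|ki] := eqVneq k i; have [->|qj] := eqVneq q j.
Qed.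

Lemma model_ball_julia (M : 'MT) : sqabs (M i j) < 1 ->
  model_ball (julia M) <-> pivot_ball M.
Proof.
move=> x1; apply: (@contraction_slice _ _ (complex_mx M) _ _ i j (cosine (M i j))).
- exact: cosine_gt0.
- by rewrite /cosine x1 sqr_sqrtr ?subr_ge0 1?ltW// mxE.
- move=> k q; rewrite !mxE xpair_eqE; case: ifP => // _.
  exact: toC_zero.
- by move=> k q; rewrite toC_julia !mxE.
Qed.

Definition jacobian (t : T) : R := \prod_(e <- cross_entries) cosine t ^+ dimT S.

Lemma jacobian_ge0 t : 0 <= jacobian t.
Proof. by apply: prodr_ge0 => e _; rewrite exprn_ge0// ltW// cosine_gt0. Qed.

Lemma measurable_jacobian : measurable_fun setT jacobian.
Proof.
by apply: measurable_prod => e _; apply: measurable_funX; exact: measurable_cosine.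
Qed.

Let measurable_pivot_entry : measurable_fun setT (fun M : 'MT => M i j).
Proof. exact: measurable_entry. Qed.

Let measurable_inner_shift (e : 'I_n * 'I_n) : measurable_fun setT
  (fun M : 'MT => tripleT S (M i j) (M e.1 j) (M i e.2)).
Proof.
have mE k q : measurable_fun setT (fun M : 'MT => M k q) by exact: measurable_entry.
have mR k q : measurable_fun setT (fun M : 'MT => complex.Re (toC S (M k q))).
  exact: (measurableT_comp (measurable_Re_toC S)).
have mI k q : measurable_fun setT (fun M : 'MT => complex.Im (toC S (M k q))).
  exact: (measurableT_comp (measurable_Im_toC S)).
apply: (@measurable_of_toC _ _ _ _ S).
- rewrite (_ : (fun M : 'MT => _) = fun M : 'MT =>
    - ((complex.Re (toC S (M i j)) * complex.Re (toC S (M e.1 j)) +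
        complex.Im (toC S (M i j)) * complex.Im (toC S (M e.1 j))) *
       complex.Re (toC S (M i e.2)) -
       (complex.Re (toC S (M i j)) * complex.Im (toC S (M e.1 j)) -
        complex.Im (toC S (M i j)) * complex.Re (toC S (M e.1 j))) *
       complex.Im (toC S (M i e.2)))).
    apply: measurable_funN; apply: measurable_funB; apply: measurable_funM => //.
      by apply: measurable_funD; apply: measurable_funM.
    by apply: measurable_funB; apply: measurable_funM.
  apply/funext => M; rewrite toC_triple.
  by case: (toC S (M i j)) (toC S (M e.1 j)) (toC S (M i e.2)) =>
    [a b] [u v] [x y] /=; ring.
- rewrite (_ : (fun M : 'MT => _) = fun M : 'MT =>
    - ((complex.Re (toC S (M i j)) * complex.Re (toC S (M e.1 j)) +
        complex.Im (toC S (M i j)) * complex.Im (toC S (M e.1 j))) *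
       complex.Im (toC S (M i e.2)) +
       (complex.Re (toC S (M i j)) * complex.Im (toC S (M e.1 j)) -
        complex.Im (toC S (M i j)) * complex.Re (toC S (M e.1 j))) *
       complex.Re (toC S (M i e.2)))).
    apply: measurable_funN; apply: measurable_funD; apply: measurable_funM => //.
      by apply: measurable_funD; apply: measurable_funM.
    by apply: measurable_funB; apply: measurable_funM.
  apply/funext => M; rewrite toC_triple.
  by case: (toC S (M i j)) (toC S (M e.1 j)) (toC S (M i e.2)) =>
    [a b] [u v] [x y] /=; ring.
Qed.

Lemma measurable_shear : measurable_fun setT shear.
Proof. by apply: measurable_aff_entries => // e; exact: measurable_cst. Qed.

Lemma measurable_dilate : measurable_fun setT dilate.
Proof.
apply: measurable_aff_entries => e; last exact: measurable_cst.
by apply: (measurableT_comp measurable_cosine).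
Qed.

Lemma measurable_julia : measurable_fun setT julia.
Proof. exact: (measurableT_comp measurable_dilate measurable_shear). Qed.

Local Open Scope ereal_scope.

Lemma integral_julia (F : 'MT -> \bar R) : measurable_fun setT F ->
  (forall M, 0 <= F M) ->
  \int[mp]_M F M = \int[mp]_M ((jacobian (M i j))%:E * F (julia M)).
Proof.
move=> mF F0.
have ucross : uniq cross_entries by rewrite filter_uniq// enum_uniq.
have uinner : uniq inner_entries by rewrite filter_uniq// enum_uniq.
have mcos (e : 'I_n * 'I_n) : measurable_fun setT (fun M : 'MT => cosine (M i j)).
  exact: (measurableT_comp measurable_cosine).
have mzero (e : 'I_n * 'I_n) : measurable_fun setT (fun M : 'MT => zeroT S).
  exact: measurable_cst.
have m1 (e : 'I_n * 'I_n) : measurable_fun setT (fun M : 'MT => 1%R : R).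
  exact: measurable_cst.
have pivot_cross : {in cross_entries &, forall e f (M : 'MT) x,
    cosine (set_entry M f x i j) = cosine (M i j)}.
  move=> _ [k q] _ + M x; rewrite mem_cross set_entryE => kq.
  by case: ((i, j) =P (k, q)) kq => [[<- <-]|//]; rewrite !eqxx.
rewrite (integral_affine_entries S ucross mcos mzero
  (fun _ M => cosine_gt0 _) pivot_cross)//.
have margs_inner : {in inner_entries &, forall e f (M : 'MT) x,
    tripleT S (set_entry M f x i j) (set_entry M f x e.1 j) (set_entry M f x i e.2)
    = tripleT S (M i j) (M e.1 j) (M i e.2)}.
  move=> e [k q] _ + M x; rewrite mem_inner => /andP[/negbTE ki /negbTE qj].
  by rewrite !set_entryE !xpair_eqE (eq_sym i) (eq_sym j) ki qj !andbF.
rewrite (integral_affine_entries S uinner m1 measurable_inner_shift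
  (fun _ _ => ltr01) _ margs_inner)//; last 2 first.
- apply: emeasurable_funM; last exact: (measurableT_comp mF measurable_dilate).
  by apply/measurable_EFinP; apply: (measurableT_comp measurable_jacobian).
- by move=> M; rewrite mule_ge0// lee_fin jacobian_ge0.
apply: eq_integral => M _.
by rewrite big1 ?mul1e -/(shear M) ?shear_pivot// => e _; rewrite expr1n.
Qed.


(** Jacobian density of the slice over t, cut off outside the unit disk. *)
Definition weight (t : T) : R := (jacobian t * \1_[set t | sqabs t < 1] t)%R.

Lemma weight_ge0 t : (0 <= weight t)%R.
Proof. by rewrite mulr_ge0 ?jacobian_ge0// indicE. Qed.

Lemma measurable_disk : measurable [set t : T | (sqabs t < 1)%R].
Proof.
rewrite (_ : mkset _ = setT `&` sqabs @^-1` `]-oo, 1%R[); last first.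
  by apply/seteqP; split=> t; rewrite /= in_itv /=; [split|case].
by apply: measurable_sqabs => //; exact: measurable_itv.
Qed.

Lemma measurable_weight : measurable_fun setT weight.
Proof.
apply: measurable_funM; first exact: measurable_jacobian.
exact: measurable_indic measurable_disk.
Qed.

Variable B : set T.
Hypotheses (mB : measurable B) (B1 : mu B = 1).

(** Integrating this function against the measure on matrices amounts to
    integrating over the slice above 0: B has mass 1 and the second factor does
    not depend on the entry (i, j). *)
Definition base (M : 'MT) : R := (\1_B (M i j) * \1_pivot_ball M)%R.

Lemma base_ge0 M : (0 <= base M)%R.
Proof. by rewrite mulr_ge0// indicE. Qed.

Lemma measurable_base : measurable_fun setT base.
Proof.
apply: measurable_funM; last exact: measurable_indic measurable_pivot_ball.
by apply: (@measurableT_comp _ _ _ _ _ _ (\1_B : T -> R)) => //; exact: measurable_indic.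
Qed.

Lemma pivot_ball_set_entry M x : pivot_ball (set_entry M (i, j) x) = pivot_ball M.
Proof. by rewrite /pivot_ball /= set_entry_twice. Qed.

Lemma indic_pivot_ball M x :
  \1_pivot_ball (set_entry M (i, j) x) = \1_pivot_ball M :> R.
Proof.
have E : (set_entry M (i, j) x \in pivot_ball) = (M \in pivot_ball).
  by apply/idP/idP => /set_mem H; apply/mem_set; move: H; rewrite pivot_ball_set_entry.
by rewrite /indic E.
Qed.

Section disintegration.
Variables (f : T -> R) (g : 'MT -> R).
Hypotheses (mf : measurable_fun setT f) (f0 : forall t, (0 <= f t)%R).
Hypotheses (mg : measurable_fun setT g) (g0 : forall M, (0 <= g M)%R).

Let F1 (M : 'MT) : R := (\1_model_ball M * (f (M i j) * g M))%R.
Let F2 (M : 'MT) : R := (\1_[set t | sqabs t < 1] (M i j) * F1 M)%R.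

Let F1_ge0 M : (0 <= F1 M)%R.
Proof. by rewrite !mulr_ge0// indicE. Qed.

Let F2_ge0 M : (0 <= F2 M)%R.
Proof. by rewrite mulr_ge0// indicE. Qed.

Let mF1 : measurable_fun setT F1.
Proof.
apply: measurable_funM; first exact: measurable_indic measurable_model_ball.
by apply: measurable_funM => //; exact: (measurableT_comp mf).
Qed.

Let mF2 : measurable_fun setT F2.
Proof.
apply: measurable_funM => //.
apply: (@measurableT_comp _ _ _ _ _ _ (\1_[set t | (sqabs t < 1)%R] : T -> R)) => //.
exact: measurable_indic measurable_disk.
Qed.

(** A contraction has entries in the closed unit disk, and the unit circle is
    negligible. *)
Let integral_F12 : \int[mp]_M (F1 M)%:E = \int[mp]_M (F2 M)%:E.
Proof.
have mE1 : measurable_fun setT (fun M => (F1 M)%:E) by exact/measurable_EFinP.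
have e1 M : 0 <= (F1 M)%:E by rewrite lee_fin.
have e2 M : 0 <= (F2 M)%:E by rewrite lee_fin.
have mE2 : measurable_fun setT (fun M => (F2 M)%:E) by exact/measurable_EFinP.
have E1 := @entry_fubini _ _ _ _ _ mu B (i, j) (fun M => (F1 M)%:E) mB B1 mE1 e1.
have E2 := @entry_fubini _ _ _ _ _ mu B (i, j) (fun M => (F2 M)%:E) mB B1 mE2 e2.
rewrite {}E1 {}E2.
apply: eq_integral => M _.
have mM (F : 'MT -> \bar R) : measurable_fun setT F -> measurable_fun setT
    (fun x => (\1_B (M (i, j).1 (i, j).2))%:E * F (set_entry M (i, j) x)).
  move=> mF; apply: emeasurable_funM; first exact: measurable_cst.
  exact: (measurableT_comp mF (measurable_set_entry_val _ _)).
apply: ae_eq_integral => //.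
- exact: (mM (fun M => (F1 M)%:E)).
- exact: (mM (fun M => (F2 M)%:E)).
exists [set x | sqmod (toC S x) = 1%R]; split.
- rewrite -[X in measurable X]setTI.
  rewrite (_ : [set x | _] = sqabs @^-1` [set 1%R])//.
  by apply: measurable_sqabs.
- exact: unit_circle_null.
- move=> x /=; apply: contra_notP => x1 _; congr (_ * _%:E).
  rewrite /F2 set_entry_same !indicE.
  have [Kx|Kx] := boolP (set_entry M (i, j) x \in model_ball); last first.
    by rewrite /F1 indicE (negbTE Kx) !mul0r mulr0.
  rewrite mem_set ?mul1r//=.
  have := contraction_entry i j (set_mem Kx).
  rewrite mxE set_entry_same le_eqVlt => /orP[/eqP//|//].
Qed.

(** Up to a null set, the change of variables [julia] parametrizes the ball by
    the entry x in the open unit disk and a point of the slice over 0. *)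
Lemma ball_disintegration :
  \int[mp]_(M in model_ball) (f (M i j) * g M)%:E =
  \int[mp]_M ((base M)%:E *
    \int[mu]_x (weight x * f x * g (julia (set_entry M (i, j) x)))%:E).
Proof.
transitivity (\int[mp]_M (F1 M)%:E).
  rewrite integral_mkcond; apply: eq_integral => M _.
  by rewrite patchE /F1 indicE; case: ifP => _; rewrite ?mul1r ?mul0r.
rewrite integral_F12 integral_julia//; last exact/measurable_EFinP.
transitivity (\int[mp]_M (\1_pivot_ball M *
    (weight (M i j) * f (M i j) * g (julia M)))%:E).
  apply: eq_integral => M _; rewrite -EFinM; congr EFin.
  rewrite /F2 /F1 julia_pivot /weight /indic.
  have [x1|x1] := boolP (M i j \in [set t | (sqabs t < 1)%R]); last first.
    by rewrite !(mul0r, mulr0).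
  suff -> : (julia M \in model_ball) = (M \in pivot_ball).
    rewrite !mul1r mulr1; ring.
  have KK := @model_ball_julia M (set_mem x1).
  by apply/idP/idP => /set_mem H; apply/mem_set; [exact: KK.1 H|exact: KK.2 H].
have mH : measurable_fun setT (fun M : 'MT => weight (M i j) * f (M i j) * g (julia M))%R.
  apply: measurable_funM; last exact: (measurableT_comp mg measurable_julia).
  apply: measurable_funM; first exact: (measurableT_comp measurable_weight).
  exact: (measurableT_comp mf).
have H0 (M : 'MT) : (0 <= weight (M i j) * f (M i j) * g (julia M))%R.
  by apply: mulr_ge0 => //; apply: mulr_ge0 => //; exact: weight_ge0.
rewrite (@entry_fubini _ _ _ _ _ mu B (i, j))//; last 2 first.
- apply/measurable_EFinP; apply: measurable_funM => //.
  exact: measurable_indic measurable_pivot_ball.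
- by move=> M; rewrite lee_fin mulr_ge0// indicE.
apply: eq_integral => M _.
rewrite -ge0_integralZl//.
- apply: eq_integral => x _; rewrite -!EFinM; congr EFin.
  by rewrite set_entry_same indic_pivot_ball mulrA.
- apply/measurable_EFinP.
  have := measurableT_comp mH (measurable_set_entry_val M (i, j)).
  by apply: eq_measurable_fun => x _ /=; rewrite set_entry_same.
- move=> x _; rewrite lee_fin.
  by have := H0 (set_entry M (i, j) x); rewrite set_entry_same.
- by rewrite lee_fin base_ge0.
Qed.

End disintegration.


Lemma sqabs_opp t : sqabs (oppT S t) = sqabs t.
Proof.
by rewrite /sqabs toC_opp; case: (toC S t) => u v; rewrite /sqmod /= !sqrrN.
Qed.

Lemma weight_opp t : weight (oppT S t) = weight t.
Proof.
rewrite /weight /jacobian; congr (_ * _)%R.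
  by apply: eq_bigr => e _; rewrite /cosine sqabs_opp.
have E : (oppT S t \in [set t | (sqabs t < 1)%R]) = (t \in [set t | (sqabs t < 1)%R]).
  by apply/idP/idP => /set_mem H; apply/mem_set; move: H; rewrite /= sqabs_opp.
by rewrite /indic E.
Qed.

Lemma measurable_sqmod_shift (u v : R[i]) :
  measurable_fun setT (fun x => sqmod (u - conjc (toC S x) * v)%R).
Proof.
have mR := measurable_Re_toC S; have mI := measurable_Im_toC S.
have mc (c : R) : measurable_fun [set: T] (fun=> c) by exact: measurable_cst.
case: u v => [u1 u2] [v1 v2].
rewrite (_ : (fun x => _) = fun x : T =>
  ((u1 - (complex.Re (toC S x) * v1 + complex.Im (toC S x) * v2)) ^+ 2 +
   (u2 - (complex.Re (toC S x) * v2 - complex.Im (toC S x) * v1)) ^+ 2)%R).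
  apply: measurable_funD; apply: measurable_funX; apply: measurable_funB => //.
    by apply: measurable_funD; apply: measurable_funM.
  by apply: measurable_funB; apply: measurable_funM.
by apply/funext => x; case: (toC S x) => a b; rewrite /sqmod /=; ring.
Qed.

Lemma sqmod_parallelogram (x u v : R[i]) :
  (sqmod (u - conjc x * v) + sqmod (u - conjc x * - v) =
   2 * (sqmod u + sqmod x * sqmod v))%R.
Proof.
by case: x u v => [x1 x2] [u1 u2] [v1 v2]; rewrite /sqmod /=; ring.
Qed.

(** The substitution of - x for x and the parallelogram identity eliminate the
    cross term without leaving nonnegative integrands. *)
Lemma integral_symmetrization (f : T -> R) (u v : R[i]) :
  measurable_fun setT f -> (forall t, (0 <= f t)%R) ->
  (forall t, f (oppT S t) = f t) ->
  \int[mu]_x (f x * sqmod (u - conjc (toC S x) * v)%R)%:E =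
  \int[mu]_x (f x * (sqmod u + sqabs x * sqmod v))%:E.
Proof.
move=> mf f0 fN.
pose q x : R := (f x * sqmod (u - conjc (toC S x) * v)%R)%R.
pose q' x : R := (f x * sqmod (u - conjc (toC S x) * - v)%R)%R.
have mq : measurable_fun setT q.
  by apply: measurable_funM => //; exact: measurable_sqmod_shift.
have mq' : measurable_fun setT q'.
  by apply: measurable_funM => //; exact: measurable_sqmod_shift.
have q0 x : 0 <= (q x)%:E by rewrite lee_fin mulr_ge0// sqmod_ge0.
have q'0 x : 0 <= (q' x)%:E by rewrite lee_fin mulr_ge0// sqmod_ge0.
have qq' : \int[mu]_x (q x)%:E = \int[mu]_x (q' x)%:E.
  rewrite (@integral_oppT _ _ _ _ S (fun x => (q x)%:E))//; last exact/measurable_EFinP.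
  apply: eq_integral => x _; rewrite /q /q' fN toC_opp.
  by congr (_ * sqmod (_ - _))%:E; rewrite rmorphN mulNr mulrN.
have half0 : (0 <= (2^-1 : R)%:E) by rewrite lee_fin invr_ge0.
transitivity (\int[mu]_x ((2^-1)%:E * (q x)%:E + (2^-1)%:E * (q' x)%:E)).
  rewrite ge0_integralD//; last 4 first.
  - by move=> x _; rewrite mule_ge0.
  - by apply: emeasurable_funM; [exact: measurable_cst|exact/measurable_EFinP].
  - by move=> x _; rewrite mule_ge0.
  - by apply: emeasurable_funM; [exact: measurable_cst|exact/measurable_EFinP].
  rewrite !ge0_integralZl//; [|exact/measurable_EFinP|exact/measurable_EFinP].
  rewrite -qq' -ge0_muleDl// -EFinD.
  by rewrite (_ : 2^-1 + 2^-1 = 1 :> R)%R ?mul1e//; field.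
apply: eq_integral => x _; rewrite -!EFinM -EFinD; congr EFin.
rewrite -mulrDr /q /q' -mulrDr sqmod_parallelogram -/(sqabs x).
by rewrite mulrCA mulKf.
Qed.

Definition pivot_moment (k : nat) : \bar R :=
  \int[mu]_x (weight x * sqabs x ^+ k)%:E.
Definition base_mass : \bar R := \int[mp]_M (base M)%:E.
Definition base_entry : \bar R := \int[mp]_M (base M * sqabs (M l r))%:E.
Definition base_cross : \bar R :=
  \int[mp]_M (base M * (sqabs (M l j) * sqabs (M i r)))%:E.

Lemma measurable_weight_sqabs k :
  measurable_fun setT (fun x => weight x * sqabs x ^+ k)%R.
Proof.
apply: measurable_funM; first exact: measurable_weight.
by apply: measurable_funX; exact: measurable_sqabs.
Qed.

Lemma weight_sqabs_ge0 k x : (0 <= weight x * sqabs x ^+ k)%R.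
Proof. by rewrite mulr_ge0 ?weight_ge0// exprn_ge0// sqabs_ge0. Qed.

Lemma measurable_sqabs_entry k q : measurable_fun setT (fun M : 'MT => sqabs (M k q)).
Proof. by apply: (measurableT_comp measurable_sqabs); exact: measurable_entry. Qed.

Lemma pivot_moment_ge0 k : 0 <= pivot_moment k.
Proof. by apply: integral_ge0 => x _; rewrite lee_fin weight_sqabs_ge0. Qed.

Lemma ball_pivot_moment k :
  \int[mp]_(M in model_ball) (sqabs (M i j) ^+ k)%:E = pivot_moment k * base_mass.
Proof.
have := @ball_disintegration (fun t => sqabs t ^+ k)%R (fun=> 1%R).
under eq_integral do rewrite mulr1.
move=> -> //; last 2 first.
- by apply: measurable_funX; exact: measurable_sqabs.
- by move=> t; rewrite exprn_ge0// sqabs_ge0.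
under eq_integral => M _.
  under eq_integral => x _ do rewrite mulr1.
  over.
rewrite ge0_integralZr//.
- by rewrite muleC.
- by apply/measurable_EFinP; exact: measurable_base.
- by move=> M _; rewrite lee_fin base_ge0.
- exact: pivot_moment_ge0.
Qed.

Lemma ball_pair_moment k :
  \int[mp]_(M in model_ball) (sqabs (M i j) ^+ k * sqabs (M l r))%:E =
  pivot_moment k * base_entry + pivot_moment k.+1 * base_cross.
Proof.
rewrite (@ball_disintegration (fun t => sqabs t ^+ k)%R
  (fun M => sqabs (M l r)))//; last 4 first.
- by apply: measurable_funX; exact: measurable_sqabs.
- by move=> t; rewrite exprn_ge0// sqabs_ge0.
- exact: measurable_sqabs_entry.
- by move=> M; exact: sqabs_ge0.
have mEp m : measurable_fun setT (fun x => (weight x * sqabs x ^+ m)%:E).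
  by apply/measurable_EFinP; exact: measurable_weight_sqabs.
transitivity (\int[mp]_M (
    pivot_moment k * (base M * sqabs (M l r))%:E +
    pivot_moment k.+1 * (base M * (sqabs (M l j) * sqabs (M i r)))%:E)).
  apply: eq_integral => M _.
  transitivity ((base M)%:E * \int[mu]_x (weight x * sqabs x ^+ k *
      (sqabs (M l r) + sqabs x * (sqabs (M l j) * sqabs (M i r))))%:E).
    congr (_ * _).
    rewrite -sqmodM -integral_symmetrization.
    - apply: eq_integral => x _; congr (_ * _)%:E.
      have := toC_julia (set_entry M (i, j) x) l r.
      rewrite mxE (eq_sym l) (negbTE il) (eq_sym r) (negbTE jr) /sqabs => ->.
      rewrite !set_entryE !xpair_eqE !eqxx (eq_sym l) (negbTE il).
      by rewrite (eq_sym r) (negbTE jr) -mulrA.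
    - exact: measurable_weight_sqabs.
    - exact: weight_sqabs_ge0.
    - by move=> x; rewrite weight_opp sqabs_opp.
  move: (base M) => bM.
  rewrite (EFinM bM) (EFinM bM (_ * _)).
  rewrite (muleC (pivot_moment k)) (muleC (pivot_moment k.+1)) -!muleA.
  rewrite -ge0_muleDr; last 2 first.
  - by rewrite mule_ge0 ?lee_fin ?sqabs_ge0 ?pivot_moment_ge0.
  - by rewrite mule_ge0 ?lee_fin ?mulr_ge0 ?sqabs_ge0 ?pivot_moment_ge0.
  congr (_ * _).
  rewrite -ge0_integralZl//; last 2 first.
  - by move=> x _; rewrite lee_fin weight_sqabs_ge0.
  - by rewrite lee_fin sqabs_ge0.
  rewrite -ge0_integralZl//; last 2 first.
  - by move=> x _; rewrite lee_fin weight_sqabs_ge0.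
  - by rewrite lee_fin mulr_ge0 ?sqabs_ge0.
  rewrite -ge0_integralD//; last 4 first.
  - by move=> x _; rewrite mule_ge0 ?lee_fin ?weight_sqabs_ge0 ?sqabs_ge0.
  - by apply: emeasurable_funM => //; exact: measurable_cst.
  - by move=> x _; rewrite mule_ge0 ?lee_fin ?weight_sqabs_ge0 ?mulr_ge0 ?sqabs_ge0.
  - by apply: emeasurable_funM => //; exact: measurable_cst.
  apply: eq_integral => x _; rewrite -!EFinM -EFinD; congr EFin.
  by rewrite exprSr; ring.
have mE1 : measurable_fun setT (fun M => (base M * sqabs (M l r))%:E).
  apply/measurable_EFinP; apply: measurable_funM; first exact: measurable_base.
  exact: measurable_sqabs_entry.
have mE2 : measurable_fun setT (fun M => (base M * (sqabs (M l j) * sqabs (M i r)))%:E).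
  apply/measurable_EFinP; apply: measurable_funM; first exact: measurable_base.
  by apply: measurable_funM; exact: measurable_sqabs_entry.
have E10 M : 0 <= (base M * sqabs (M l r))%:E.
  by rewrite lee_fin mulr_ge0 ?base_ge0 ?sqabs_ge0.
have E20 M : 0 <= (base M * (sqabs (M l j) * sqabs (M i r)))%:E.
  by rewrite lee_fin !mulr_ge0 ?base_ge0 ?sqabs_ge0.
have pk := pivot_moment_ge0.
rewrite ge0_integralD//; last 4 first.
- by move=> M _; rewrite mule_ge0.
- by apply: emeasurable_funM => //; exact: measurable_cst.
- by move=> M _; rewrite mule_ge0.
- by apply: emeasurable_funM => //; exact: measurable_cst.
by rewrite !ge0_integralZl.
Qed.


Lemma pivot_moment_nonincreasing k : pivot_moment k.+1 <= pivot_moment k.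
Proof.
apply: ge0_le_integral => //.
- by move=> x _; rewrite lee_fin weight_sqabs_ge0.
- by apply/measurable_EFinP; exact: measurable_weight_sqabs.
- by apply/measurable_EFinP; exact: measurable_weight_sqabs.
move=> x _; rewrite lee_fin exprSr mulrA.
have [x1|x1] := ltP (sqabs x) 1%R.
  by rewrite ler_piMr ?weight_sqabs_ge0// ltW.
rewrite /weight indicE memNset ?mulr0 ?mul0r//=.
by apply/negP; rewrite -leNgt.
Qed.

(** Nonnegativity of the integral of (|x|^2 - t)^2, written without
    subtraction; t = p 1 / p 0 gives the Cauchy-Schwarz inequality. *)
Lemma pivot_moment_quadratic (t : R) : (0 <= t)%R ->
  (2 * t)%:E * pivot_moment 1 <= pivot_moment 2 + (t ^+ 2)%:E * pivot_moment 0.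
Proof.
move=> t0.
have t20 : 0 <= (t ^+ 2)%:E by rewrite lee_fin sqr_ge0.
have w0 k x : 0 <= (weight x * sqabs x ^+ k)%:E by rewrite lee_fin weight_sqabs_ge0.
have mw k : measurable_fun setT (fun x => (weight x * sqabs x ^+ k)%:E).
  by apply/measurable_EFinP; exact: measurable_weight_sqabs.
have mc (c : R) : measurable_fun [set: T] (fun=> c%:E) by exact: measurable_cst.
rewrite -!ge0_integralZl//; last by rewrite lee_fin mulr_ge0.
rewrite -ge0_integralD//; last 2 first.
- by move=> x _; rewrite mule_ge0.
- exact: emeasurable_funM.
apply: ge0_le_integral => //.
- by move=> x _; rewrite mule_ge0// lee_fin mulr_ge0.
- exact: emeasurable_funM.
- by apply: emeasurable_funD => //; exact: emeasurable_funM.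
move=> x _; rewrite -!EFinM -EFinD lee_fin -subr_ge0.
rewrite (_ : _ - _ = weight x * (sqabs x - t) ^+ 2)%R; last by ring.
by rewrite mulr_ge0 ?weight_ge0// sqr_ge0.
Qed.

(** Entries of a contraction have modulus at most 1. *)
Lemma base_sqabs_le M k q : (k, q) != (i, j) ->
  (base M * sqabs (M k q) <= base M)%R.
Proof.
move=> kq; have [KM|KM] := boolP (M \in pivot_ball); last first.
  suff -> : base M = 0%R by rewrite mul0r.
  by rewrite /base /indic (negbTE KM) mulr0.
rewrite ler_piMr ?base_ge0//.
have := contraction_entry k q (set_mem KM).
by rewrite mxE set_entryE (negbTE kq).
Qed.

Lemma base_entry_le : base_entry <= base_mass.
Proof.
apply: ge0_le_integral => //.
- by move=> M _; rewrite lee_fin mulr_ge0 ?base_ge0 ?sqabs_ge0.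
- apply/measurable_EFinP; apply: measurable_funM; first exact: measurable_base.
  exact: measurable_sqabs_entry.
- by apply/measurable_EFinP; exact: measurable_base.
move=> M _; rewrite lee_fin base_sqabs_le//.
by rewrite xpair_eqE (eq_sym l) (negbTE il).
Qed.

Lemma base_cross_le : base_cross <= base_mass.
Proof.
apply: ge0_le_integral => //.
- by move=> M _; rewrite lee_fin !mulr_ge0 ?base_ge0 ?sqabs_ge0.
- apply/measurable_EFinP; apply: measurable_funM; first exact: measurable_base.
  by apply: measurable_funM; exact: measurable_sqabs_entry.
- by apply/measurable_EFinP; exact: measurable_base.
move=> M _; rewrite lee_fin mulrA.
apply: (@le_trans _ _ (base M * sqabs (M i r))%R).
  by rewrite ler_wpM2r ?sqabs_ge0// base_sqabs_le// xpair_eqE (eq_sym l) (negbTE il).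
by rewrite base_sqabs_le// xpair_eqE (eq_sym r) (negbTE jr) andbF.
Qed.

Lemma fin_num_factors (x y : \bar R) : 0 <= x -> 0 <= y ->
  x * y \is a fin_num -> x * y != 0 ->
  [/\ x \is a fin_num, y \is a fin_num, 0 < x & 0 < y].
Proof.
move=> x0 y0 xyf xy0.
have xn0 : x != 0 by apply: contraNneq xy0 => ->; rewrite mul0e.
have yn0 : y != 0 by apply: contraNneq xy0 => ->; rewrite mule0.
have xp : 0 < x by rewrite lt_neqAle eq_sym xn0.
have yp : 0 < y by rewrite lt_neqAle eq_sym yn0.
split => //.
- rewrite ge0_fin_numE// ltey; apply/eqP => xoo.
  by move: xyf; rewrite xoo gt0_mulye.
- rewrite ge0_fin_numE// ltey; apply/eqP => yoo.
  by move: xyf; rewrite yoo gt0_muley.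
Qed.

(** When vol K is 0 or infinite its real value is 0, and both sides vanish.
    Otherwise all the moments are finite, being dominated by p 0 and V. *)
Lemma ball_correlation_aux (m := fine (mp model_ball)) :
  ((m^-1 * \int[mp]_(M in model_ball) sqabs (M i j)) *
   (m^-1 * \int[mp]_(M in model_ball) sqabs (M l r)) <=
   m^-1 * \int[mp]_(M in model_ball) (sqabs (M i j) * sqabs (M l r)))%R.
Proof.
have mE : mp model_ball = pivot_moment 0 * base_mass.
  rewrite -ball_pivot_moment; under eq_integral do rewrite expr0.
  by rewrite integral_cst ?mul1e//; exact: measurable_model_ball.
have [m0|m0] := eqVneq m 0%R; first by rewrite m0 invr0 !mul0r.
have fm : mp model_ball \is a fin_num.
  by move: m0; rewrite /m; case: (mp model_ball) => //=; rewrite eqxx.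
have V0 : 0 <= base_mass by apply: integral_ge0 => M _; rewrite lee_fin base_ge0.
have [|| fp0 fV p0_gt0 V_gt0] := fin_num_factors (pivot_moment_ge0 0) V0.
- by rewrite -mE.
- by rewrite -mE; apply: contraNneq m0 => m0; rewrite /m m0.
have fp1 : pivot_moment 1 \is a fin_num.
  rewrite ge0_fin_numE ?pivot_moment_ge0//.
  by rewrite (le_lt_trans (pivot_moment_nonincreasing 0))// -ge0_fin_numE ?pivot_moment_ge0.
have fp2 : pivot_moment 2 \is a fin_num.
  rewrite ge0_fin_numE ?pivot_moment_ge0//.
  by rewrite (le_lt_trans (pivot_moment_nonincreasing 1))// -ge0_fin_numE ?pivot_moment_ge0.
have a0 : 0 <= base_entry.
  by apply: integral_ge0 => M _; rewrite lee_fin mulr_ge0 ?base_ge0 ?sqabs_ge0.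
have b0 : 0 <= base_cross.
  by apply: integral_ge0 => M _; rewrite lee_fin !mulr_ge0 ?base_ge0 ?sqabs_ge0.
have fa : base_entry \is a fin_num.
  by rewrite ge0_fin_numE// (le_lt_trans base_entry_le)// -ge0_fin_numE.
have fb : base_cross \is a fin_num.
  by rewrite ge0_fin_numE// (le_lt_trans base_cross_le)// -ge0_fin_numE.
rewrite /Rintegral /m mE.
have E2 : \int[mp]_(M in model_ball) (sqabs (M i j))%:E =
    pivot_moment 1 * base_mass.
  by rewrite -ball_pivot_moment; apply: eq_integral => M _; rewrite expr1.
have E1 : \int[mp]_(M in model_ball) (sqabs (M i j) * sqabs (M l r))%:E =
    pivot_moment 1 * base_entry + pivot_moment 2 * base_cross.
  by rewrite -ball_pair_moment; apply: eq_integral => M _; rewrite expr1.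
have E0 : \int[mp]_(M in model_ball) (sqabs (M l r))%:E =
    pivot_moment 0 * base_entry + pivot_moment 1 * base_cross.
  by rewrite -ball_pair_moment; apply: eq_integral => M _; rewrite expr0 mul1r.
rewrite {}E2 {}E1 {}E0 {mE fm m0 m}.
have := pivot_moment_quadratic.
have := pivot_moment_ge0 1.
rewrite -(fineK fp0) -(fineK fp1) -(fineK fp2) -(fineK fa) -(fineK fb) -(fineK fV).
move: p0_gt0 V_gt0 b0; rewrite -(fineK fp0) -(fineK fV) -(fineK fb) /=.
rewrite !lte_fin !lee_fin.
set p0 := fine (pivot_moment 0); set p1 := fine (pivot_moment 1).
set p2 := fine (pivot_moment 2); set a := fine base_entry.
set b := fine base_cross; set V := fine base_mass.
move=> p0_gt0 V_gt0 b0 p10.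
have t0 : (0 <= p1 / p0)%R by rewrite divr_ge0// ltW.
move=> /(_ _ t0).
rewrite -!EFinM -!EFinD !lee_fin /= => cs.
rewrite -subr_ge0.
(* The difference of the two sides is b / (p0 V) times the variance term
   p2 - p1^2 / p0, here in the form given by the quadratic inequality. *)
rewrite (_ : (_ - _)%R = b / (p0 * V) * (p2 + (p1 / p0) ^+ 2 * p0 - 2 * (p1 / p0) * p1))%R.
  by rewrite mulr_ge0 ?subr_ge0// divr_ge0// mulr_ge0// ltW.
by field; rewrite !gt_eqF.
Qed.

End ball_moments.

Lemma ball_correlation d (T : measurableType d) (R : realType) (n : nat)
    (mu : {sigma_finite_measure set T -> \bar R}) (S : scalar_model mu)
    (i l j r : 'I_n) (K := model_ball (n := n) S)
    (mp := matrix_power mu (m := n) (n := n)) (m := fine (mp K)) :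
  i != l -> j != r ->
  ~ (m^-1 * \int[mp]_(M in K) (sqabs S (M i j) * sqabs S (M l r)) <
     (m^-1 * \int[mp]_(M in K) sqabs S (M i j)) *
     (m^-1 * \int[mp]_(M in K) sqabs S (M l r))).
Proof.
move=> il jr; have [B mB B1] := unit_mass S.
by apply/negP; rewrite -leNgt; exact: (ball_correlation_aux S il jr mB B1).
Qed.

(** * Lebesgue measure on the line and on the complex plane *)

Section lebesgue_line.
Context (R : realType).
Local Notation leb := (@lebesgue_measure R).
Local Notation RT := (measurableTypeR R).
Local Open Scope ereal_scope.

Lemma measurable_affine (s c : R) :
  measurable_fun setT ((fun x => s * x + c)%R : RT -> RT).
Proof.
by apply: measurable_funD; [exact: mulrl_measurable|exact: measurable_cst].
Qed.

Lemma lebesgue_measure_affine (s c : R) (A : set RT) : (0 < s)%R -> measurable A ->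
  leb A = s%:E * leb ((fun x => s * x + c)%R @^-1` A).
Proof.
move=> s0 mA.
pose q : {measure set RT -> \bar R} :=
  measure_function_pushforward__canonical__measure_function_Measure
    leb (measurable_affine s c).
have sn : (0 <= s)%R by exact: ltW.
pose qs : {measure set RT -> \bar R} := mscale (NngNum sn) q.
transitivity (qs A); last by [].
apply: lebesgue_measure_unique => //= _ [[a b]] _ <- /=.
rewrite /qs /mscale /q /= /pushforward.
rewrite (_ : _ @^-1` _ = [set` `](a - c) / s, (b - c) / s]%R]); last first.
  apply/seteqP; split=> x /=; rewrite !in_itv /=;
    by rewrite ltr_pdivrMr// ler_pdivlMr// ltrBlDr lerBrDr mulrC.
rewrite !lebesgue_measure_itv /= !lte_fin ltr_pM2r ?invr_gt0// ltrD2r.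
case: ifP => _; last by rewrite mule0.
rewrite -!EFinB -EFinM; congr EFin; field.
by rewrite gt_eqF.
Qed.

Lemma integral_lebesgue_affine (s c : R) (g : RT -> \bar R) : (0 < s)%R ->
  measurable_fun setT g -> (forall x, 0 <= g x) ->
  \int[leb]_x g x = s%:E * \int[leb]_x g (s * x + c)%R.
Proof.
move=> s0 mg g0.
pose q : {measure set RT -> \bar R} :=
  measure_function_pushforward__canonical__measure_function_Measure
    leb (measurable_affine s c).
have sn : (0 <= s)%R by exact: ltW.
transitivity (\int[mscale (NngNum sn) q]_x g x).
  by apply: eq_measure_integral => A mA _; exact: lebesgue_measure_affine.
rewrite ge0_integral_mscale//; congr (_ * _).
by rewrite ge0_integral_pushforward//; exact: measurable_affine.
Qed.

Lemma integral_lebesgue_opp (g : RT -> \bar R) :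
  measurable_fun setT g -> (forall x, 0 <= g x) ->
  \int[leb]_x g x = \int[leb]_x g (- x)%R.
Proof.
move=> mg g0.
have mN : measurable_fun setT (-%R : RT -> RT) by exact: oppr_measurable.
transitivity (\int[pushforward leb (-%R : RT -> RT)]_x g x).
  apply: eq_measure_integral => // A mA _.
  exact/esym/lebesgue_measureN.
by rewrite ge0_integral_pushforward.
Qed.

Lemma lebesgue_measure_unit : leb [set` `[0%R : R, 1%R]] = 1.
Proof. by rewrite lebesgue_measure_itv /= lte_fin ltr01 oppr0 adde0. Qed.

End lebesgue_line.

Section real_model.
Context (R : realType).
Local Notation leb := (@lebesgue_measure R).
Local Notation RT := (measurableTypeR R).

Definition real_model : @scalar_model _ RT R leb.
Proof.
apply: (@ScalarModel _ _ _ _ (fun x : RT => (x%:C)%C : R[i]) _ _ _ (0 : R) _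
  (fun x : RT => - (x : R)) _ (fun s c x => s * (x : R) + (c : R)) _
  (fun x z y => - ((x : R) * (z : R) * (y : R))) _ 1).
- exact: measurable_id.
- exact: measurable_cst.
- by move=> d' X f mf _.
- by [].
- by move=> x; rewrite -rmorphN.
- by move=> s c x; rewrite rmorphD rmorphM.
- by move=> x z y; rewrite conjc_real rmorphN !rmorphM.
- move=> s c g s0 mg g0; rewrite expr1.
  rewrite (integral_lebesgue_affine c s0 mg g0) ge0_integralZl//.
    exact: (measurableT_comp mg (measurable_affine s c)).
  by rewrite lee_fin ltW.
- exact: integral_lebesgue_opp.
- exists ([set` `[(0 : R), 1]]) => //.
  exact: lebesgue_measure_unit.

- apply: countable_lebesgue_measure0; apply: finite_set_countable.
  apply: (@sub_finite_set _ _ [set 1; -1]); last exact: finite_set2.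
  move=> x /=; rewrite /sqmod /= expr0n addr0 => /eqP.
  by rewrite sqrf_eq1 => /orP[/eqP ->|/eqP ->]; [left|right].
Defined.

End real_model.

Section complex_model.
Context (R : realType).
Local Notation leb := (@lebesgue_measure R).
Local Notation RT := (measurableTypeR R).
Local Open Scope complex_scope.

Lemma measurable_complex_coord : measurable_fun setT (@complex_coord R).
Proof. by move=> _ A mA; exists A. Qed.

Lemma measurable_complex_fun d (X : measurableType d) (f : X -> R[i]) :
  measurable_fun setT (fun x => complex.Re (f x)) ->
  measurable_fun setT (fun x => complex.Im (f x)) ->
  measurable_fun setT f.
Proof.
move=> mR mI _ _ [A mA <-]; rewrite !setTI -comp_preimage.
have /(_ measurableT _ mA) := measurable_fun_pair
  (mR : measurable_fun setT (_ : X -> RT)) (mI : measurable_fun setT (_ : X -> RT)).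
by rewrite setTI.
Qed.

Lemma measurable_mkComplex :
  measurable_fun setT (fun p : RT * RT => (p.1 : R) +i* (p.2 : R)).
Proof.
apply: measurable_complex_fun; [exact: measurable_fst|exact: measurable_snd].
Qed.

Lemma integral_complex (g : R[i] -> \bar R) :
  measurable_fun setT g -> (forall z, (0 <= g z)%E) ->
  (\int[@lebesgue_complex R]_z g z = \int[leb]_x \int[leb]_y g ((x : R) +i* (y : R)))%E.
Proof.
move=> mg g0.
transitivity (\int[(leb \x leb)%E]_p g (((p.1 : R) +i* (p.2 : R))))%E.
  by rewrite ge0_integral_pushforward//; exact: measurable_mkComplex.
rewrite (fubini_tonelli1 (fun p : RT * RT => g ((p.1 : R) +i* (p.2 : R))))//.
exact: (measurableT_comp mg measurable_mkComplex).
Qed.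

Let measurable_inner (g : R[i] -> \bar R) (s c : R) :
  measurable_fun setT g -> (forall z, (0 <= g z)%E) ->
  measurable_fun setT (fun x : RT => \int[leb]_y g ((x : R) +i* (s * (y : R) + c)%R))%E.
Proof.
move=> mg g0.
apply: (measurable_fun_fubini_tonelli_F
  (fun p : RT * RT => g ((p.1 : R) +i* (s * (p.2 : R) + c)))) => //.
apply: (measurableT_comp mg); apply: measurable_complex_fun => /=.
  exact: measurable_fst.
by apply: (measurableT_comp (measurable_affine s c)); exact: measurable_snd.
Qed.

Lemma measurable_Re : measurable_fun setT (fun z : R[i] => complex.Re z).
Proof. exact: (measurableT_comp measurable_fst measurable_complex_coord). Qed.

Lemma measurable_Im : measurable_fun setT (fun z : R[i] => complex.Im z).
Proof. exact: (measurableT_comp measurable_snd measurable_complex_coord). Qed.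

Lemma measurable_complex_affine (s : R) (c : R[i]) :
  measurable_fun setT (fun z : R[i] => s%:C * z + c).
Proof.
apply: measurable_complex_fun.
  rewrite (_ : (fun _ => _) = fun z => s * complex.Re z + complex.Re c).
    exact: (measurableT_comp (measurable_affine s _) measurable_Re).
  by apply/funext => -[a b]; case: c => u v /=; rewrite mul0r subr0.
rewrite (_ : (fun _ => _) = fun z => s * complex.Im z + complex.Im c).
  exact: (measurableT_comp (measurable_affine s _) measurable_Im).
by apply/funext => -[a b]; case: c => u v /=; rewrite mul0r addr0.
Qed.

Lemma integral_complex_affine (s : R) (c : R[i]) (g : R[i] -> \bar R) : 0 < s ->
  measurable_fun setT g -> (forall z, (0 <= g z)%E) ->
  (\int[@lebesgue_complex R]_z g z =
   (s ^+ 2)%:E * \int[@lebesgue_complex R]_z g (s%:C * z + c)%R)%E.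
Proof.
move=> s0 mg g0; have sn : 0 <= s by exact: ltW.
have maff := measurable_complex_affine s c.
rewrite (integral_complex mg g0).
rewrite (integral_complex (measurableT_comp mg maff) (fun z => g0 _)).
pose H x := (\int[leb]_y g ((x : R) +i* (s * (y : R) + complex.Im c)%R))%E.
have mH : measurable_fun setT (H : RT -> \bar R) by exact: measurable_inner.
have H0 x : (0 <= H x)%E by exact: integral_ge0.
transitivity (\int[leb]_x (s%:E * H x))%E.
  apply: eq_integral => x _; apply: integral_lebesgue_affine => //.
  apply: (measurableT_comp mg); apply: measurable_complex_fun => /=.
    exact: measurable_cst.
  exact: measurable_id.
rewrite ge0_integralZl; [|exact: measurableT|exact: mH|by move=> x _|by rewrite lee_fin].
rewrite (integral_lebesgue_affine (complex.Re c) s0 mH H0) muleA -EFinM -expr2.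
congr (_ * _)%E; apply: eq_integral => x _; apply: eq_integral => y _.
by congr g; case: c {maff H mH H0} => u v; rewrite /=; congr Complex; rewrite /=; ring.
Qed.

Lemma integral_complex_opp (g : R[i] -> \bar R) :
  measurable_fun setT g -> (forall z, (0 <= g z)%E) ->
  (\int[@lebesgue_complex R]_z g z = \int[@lebesgue_complex R]_z g (- z)%R)%E.
Proof.
move=> mg g0.
have mN : measurable_fun setT (fun z : R[i] => - z).
  apply: measurable_complex_fun.
    rewrite (_ : (fun _ => _) = fun z => - complex.Re z); last by apply/funext => -[].
    exact: (measurable_funN measurable_Re).
  rewrite (_ : (fun _ => _) = fun z => - complex.Im z); last by apply/funext => -[].
  exact: (measurable_funN measurable_Im).
rewrite (integral_complex mg g0).
rewrite (integral_complex (measurableT_comp mg mN) (fun z => g0 _)).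
pose H x := (\int[leb]_y g ((x : R) +i* (1 * (y : R) + 0)%R))%E.
have mH : measurable_fun setT (H : RT -> \bar R) by exact: measurable_inner.
have H0 x : (0 <= H x)%E by exact: integral_ge0.
have HE x : H x = (\int[leb]_y g ((x : R) +i* (y : R)))%E.
  by apply: eq_integral => y _; rewrite mul1r addr0.
transitivity (\int[leb]_x H x)%E; first by apply: eq_integral => x _; rewrite HE.
rewrite (integral_lebesgue_opp mH H0); apply: eq_integral => x _; rewrite HE.
apply: integral_lebesgue_opp => //.
apply: (measurableT_comp mg); apply: measurable_complex_fun => /=.
  exact: measurable_cst.
exact: measurable_id.
Qed.

(** Vertical lines meet the circle in at most two points. *)
Lemma lebesgue_complex_unit_circle :
  @lebesgue_complex R [set z | sqmod z = 1] = 0%E.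
Proof.
rewrite /lebesgue_complex /pushforward /product_measure1.
apply: integral0_eq => x _ /=.
apply: countable_lebesgue_measure0; apply: finite_set_countable.
apply: (@sub_finite_set _ _ [set Num.sqrt (1 - x ^+ 2); - Num.sqrt (1 - x ^+ 2)]);
  last exact: finite_set2.
move=> y; rewrite /xsection /= inE /sqmod /= => xy.
have -> : 1 - x ^+ 2 = y ^+ 2 by rewrite -xy addrAC subrr add0r.
rewrite sqrtr_sqr; case: (ger0P y) => _; [by left|right].
by rewrite opprK.
Qed.

Definition complex_model : @scalar_model _ R[i] R (@lebesgue_complex R).
Proof.
apply: (@ScalarModel _ _ _ _ (fun z : R[i] => z) _ _ _ 0 _
  (fun z => - z) _ (fun s c z => s%:C * z + c) _
  (fun x z y => - (x^* * z * y)) _ 2) => //.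
- exact: measurable_Re.
- exact: measurable_Im.
- exact: measurable_complex_fun.
- move=> s c g s0 mg g0.
  rewrite ge0_integralZl//; first exact: integral_complex_affine.
    exact: (measurableT_comp mg (measurable_complex_affine s c)).
  by rewrite lee_fin exprn_ge0// ltW.
- exact: integral_complex_opp.
- pose I01 : set RT := [set` `[(0 : R), 1]].
  have mI : measurable I01 by exact: measurable_itv.
  exists [set z | I01 (complex.Re z) /\ I01 (complex.Im z)].
    exists (I01 `*` I01); first exact: measurableX.
    by rewrite setTI.
  apply: etrans (lebesgue_complex_box mI mI) _.
  by rewrite lebesgue_measure_unit mule1.
- exact: lebesgue_complex_unit_circle.
Defined.

End complex_model.

(** * Both fields *)

Theorem mainTheorem4 (R : realType) (n : nat) (n_ge2 : (2 <= n)%N) :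
  (forall i l j r : 'I_n, i != l -> j != r ->
     ~ (mean_real (fun T : 'M[R]_n => `|T i j| ^+ 2 * `|T l r| ^+ 2) <
        mean_real (fun T : 'M[R]_n => `|T i j| ^+ 2) *
        mean_real (fun T : 'M[R]_n => `|T l r| ^+ 2))) /\
  (forall i l j r : 'I_n, i != l -> j != r ->
     ~ (mean_complex (fun T : 'M[R[i]]_n => normc (T i j) ^+ 2 * normc (T l r) ^+ 2) <
        mean_complex (fun T : 'M[R[i]]_n => normc (T i j) ^+ 2) *
        mean_complex (fun T : 'M[R[i]]_n => normc (T l r) ^+ 2))).
Proof.
split=> i l j r il jr.
- have KE : @Kinfty_real R n = model_ball (n := n) (real_model R).
    by apply/seteqP; split=> T /Kinfty_realE.
  have sE (x : R) : `|x| ^+ 2 = sqabs (real_model R) x.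
    by rewrite real_normK ?num_real// /sqabs /sqmod /= expr0n addr0.
  have := @ball_correlation _ _ _ n _ (real_model R) i l j r il jr.
  rewrite /mean_real KE.
  have eE (k q : 'I_n) : (fun T : 'M[R]_n => `|T k q| ^+ 2) =
      fun T => sqabs (real_model R) (T k q) by apply/funext => T; exact: sE.
  have -> : (fun T : 'M[R]_n => `|T i j| ^+ 2 * `|T l r| ^+ 2) = fun T =>
      sqabs (real_model R) (T i j) * sqabs (real_model R) (T l r).
    by apply/funext => T; rewrite !sE.
  by rewrite !eE.
- have KE : @Kinfty_complex R n = model_ball (n := n) (complex_model R).
    apply/seteqP; split=> T; rewrite /model_ball /= /complex_mx map_mx_id//;
      by move=> /Kinfty_complexE.
  have sE (x : R[i]) : normc x ^+ 2 = sqabs (complex_model R) x.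
    exact: sqmod_normc.
  have := @ball_correlation _ _ _ n _ (complex_model R) i l j r il jr.
  rewrite /mean_complex KE.
  have eE (k q : 'I_n) : (fun T : 'M[R[i]]_n => normc (T k q) ^+ 2) =
      fun T => sqabs (complex_model R) (T k q) by apply/funext => T; exact: sE.
  have -> : (fun T : 'M[R[i]]_n => normc (T i j) ^+ 2 * normc (T l r) ^+ 2) = fun T =>
      sqabs (complex_model R) (T i j) * sqabs (complex_model R) (T l r).
    by apply/funext => T; rewrite !sE.
  by rewrite !eE.
Qed.
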